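(* Consider $L$ parallel queues under the Join-the-Shortest-Queue (JSQ) routing policy (setting, JSQ and steady-state vector as in the context), with exogenous arrival process $\{A_\Sigma^{(\epsilon)}[t]\}_t$ of mean $\lambda_\Sigma^{(\epsilon)}$ satisfying $\epsilon=\mu_\Sigma-\lambda_\Sigma^{(\epsilon)}>0$ and variance $(\sigma_\Sigma^{(\epsilon)})^2$. Then the limiting steady-state queue-length vector $\overline{\mathbf Q}^{(\epsilon)}$ satisfies $$\mathbb E\Big[\sum_{l=1}^L \bar Q_l^{(\epsilon)}\Big]\le \frac{\zeta^{(\epsilon)}}{2\epsilon}+\overline B_1^{(\epsilon)},\qquad \zeta^{(\epsilon)}=(\sigma_\Sigma^{(\epsilon)})^2+\nu_\Sigma^2,$$ for some $\overline B_1^{(\epsilon)}$ that is $o(1/\epsilon)$, i.e. $\lim_{\epsilon\downarrow0}\epsilon\,\overline B_1^{(\epsilon)}=0$. Moreover, in the heavy-traffic limit, for a sequence of exogenous arrival processes with $\epsilon\downarrow0$ such that $(\sigma_\Sigma^{(\epsilon)})^2$ converges to a constant $\sigma_\Sigma^2$, $$\limsup_{\epsilon\downarrow0}\ \epsilon\,\mathbb E\Big[\sum_{l=1}^L \bar Q_l^{(\epsilon)}\Big]\le\frac{\zeta}{2},\qquad \zeta=\sigma_\Sigma^2+\nu_\Sigma^2 .$$ Hence JSQ is first-moment heavy-traffic optimal: in the same limit, any feasible routing policy with steady-state queue-length vector $\widehat{\mathbf Q}^{(\epsilon)}$ satisfies $\liminf_{\epsilon\downarrow0}\epsilon\,\mathbb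 E[\sum_{l}\widehat Q_l^{(\epsilon)}]\ge\zeta/2$, so JSQ attains the smallest possible limit.
   Context: Routing model. There are $L$ queues in slotted time $t=0,1,2,\dots$ with nonnegative-integer lengths $\mathbf Q[t]=(Q_l[t])_{l=1}^L$ evolving as $Q_l[t+1]=(Q_l[t]+A_l[t]-S_l[t])^+$. In each slot a random number $A_\Sigma^{(\epsilon)}[t]$ of exogenous packets arrives at a router, which chooses a nonnegative integer vector $\mathbf A[t]$ with $\sum_l A_l[t]=A^{(\epsilon)}_\Sigma[t]$; any such rule is a feasible routing policy. The exogenous arrival process and the service processes $\{S_l[t]\}_t$, $l=1,\dots,L$, are mutually independent; each is i.i.d. over time, nonnegative-integer valued and bounded: $A^{(\epsilon)}_\Sigma[t]\le A_{\max}<\infty$, $S_l[t]\le S_{\max}<\infty$, with $A_{\max},S_{\max}$ and the service processes not depending on $\epsilon$. Notation: $\mu_l=\mathbb E[S_l[1]]$, $\nu_l^2=\mathrm{var}(S_l[1])$, $\mu_\Sigma=\sum_l\mu_l$, $\nu_\Sigma^2=\sum_l\nu_l^2$, and $\min_l\mu_l>0$. JSQ: in every slot all incoming packets are sent to one of the queues of smallest length $Q_l[t]$, ties broken uniformly at random. Steady state: under JSQ with $\lambda^{(\epsilon)}_\Sigma<\mu_\Sigma$, the Markov chain $\{\mathbf Q^{(\epsilon)}[t]\}_t$ converges in distribution to a random vector $\overline{\mathbf Q}^{(\epsilon)}$ (its steady state), all of whose moments are finite; this fact is taken as part of the setting. For a general feasible policy, $\widehat{\mathbf Q}^{(\epsilon)}$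 denotes the limit in distribution of its queue-length process. *)

(* Defs.v *)
From HB Require Import structures.
From mathcomp Require Export all_boot all_order all_algebra.
From mathcomp Require Export all_classical all_reals all_analysis.

Export Order.TTheory GRing.Theory Num.Theory.
Export numFieldNormedType.Exports.

Set Implicit Arguments.
Unset Strict Implicit.
Unset Printing Implicit Defensive.

Global Open Scope classical_set_scope.
Global Open Scope ring_scope.

Section probability.
Context {d : measure_display} {T : measurableType d} {R : realType}.

Definition generators {I : Type} (X : I -> T -> nat) : set (set T) :=
  \bigcup_(i in [set: I]) preimage_set_system setT (X i) setT.

Definition sigma_gen {I : Type} (X : I -> T -> nat) : set (set T) :=
  <<s generators X >>.

(* [F] is meant to be a family of sub-sigma-algebras. *)
Definition mutually_independent (P : probability T R) {I : eqType}
    (F : I -> set (set T)) : Prop :=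
  forall (s : seq I) (B : I -> set T), uniq s ->
    (forall i, i \in s -> F i (B i)) ->
    P (\bigcap_(i in [set` s]) B i) = (\prod_(i <- s) P (B i))%E.

Definition iid (P : probability T R) (m : probability nat R)
    (X : nat -> {RV P >-> nat}) : Prop :=
  mutually_independent P (fun t => sigma_gen (fun _ : unit => X t)) /\
  forall t, distribution P (X t) =1 m.

End probability.

(* Mean and variance of a law on nat.  They are used for laws with bounded
   support only, where the extended reals below are finite. *)
Definition law_mean (R : realType) (m : probability nat R) : R :=
  fine ('E_m[fun n : nat => n%:R]).

Definition law_var (R : realType) (m : probability nat R) : R :=
  fine ('V_m[fun n : nat => n%:R]).

Definition total_mean (R : realType) (L : nat) (m : 'I_L -> probability nat R)
    : R :=
  \sum_(l < L) law_mean (m l).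

Definition total_var (R : realType) (L : nat) (m : 'I_L -> probability nat R)
    : R :=
  \sum_(l < L) law_var (m l).

Definition bounded_law (R : realType) (m : probability nat R) (M : nat) : Prop :=
  m [set n | (n <= M)%N] = 1%E.

(* A random vector with values in nat^L, on its own probability space. *)
Record random_vector (R : realType) (L : nat) := RandomVector {
  rv_disp : measure_display;
  rv_space : measurableType rv_disp;
  rv_prob : probability rv_space R;
  rv_coord : 'I_L -> {RV rv_prob >-> nat}
}.

Definition rv_expect (R : realType) (L : nat) (X : random_vector R L)
    (f : ('I_L -> nat) -> R) : \bar R :=
  'E_(rv_prob X)[fun w => f (fun l => rv_coord X l w)].

Definition mean_total (R : realType) (L : nat) (X : random_vector R L) : \bar R :=
  rv_expect X (fun q => (\sum_(l < L) q l)%N%:R).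

Definition all_moments_finite (R : realType) (L : nat) (X : random_vector R L)
    : Prop :=
  forall k : 'I_L -> nat,
    (rv_expect X (fun q => (\prod_(l < L) (q l)%:R ^+ k l)%R) < +oo)%E.

(* Every function on the discrete space nat^L is continuous, so the test
   functions of weak convergence are all the bounded ones. *)
Definition cvg_in_distribution (R : realType) (L : nat)
    (X : nat -> random_vector R L) (Y : random_vector R L) : Prop :=
  forall (f : ('I_L -> nat) -> R) (M : R), (forall q, `|f q| <= M) ->
    (fun t => rv_expect (X t) f) @ \oo --> rv_expect Y f.

(* A feasible routing policy at work.  Nothing is assumed on how [routed]
   depends on the past, on the future or on extra randomness, nor on the law
   of the initial lengths.  The truncated subtraction of nat is the positive
   part in the queue recursion. *)
Record routing_model (R : realType) (L : nat) := RoutingModel {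
  rm_disp : measure_display;
  rm_space : measurableType rm_disp;
  rm_prob : probability rm_space R;
  arrivals : nat -> {RV rm_prob >-> nat};
  services : nat -> 'I_L -> {RV rm_prob >-> nat};
  routed : nat -> 'I_L -> {RV rm_prob >-> nat};
  queue : nat -> 'I_L -> {RV rm_prob >-> nat};
  routed_sum : forall t w, (\sum_(l < L) routed t l w)%N = arrivals t w;
  queue_step : forall t l w,
    queue t.+1 l w = (queue t l w + routed t l w - services t l w)%N
}.

Definition queue_vector (R : realType) (L : nat) (m : routing_model R L)
    (t : nat) : random_vector R L :=
  RandomVector (queue m t).

(* The exogenous arrival process is indexed by [None], the service process of
   queue [l] by [Some l]. *)
Definition primitive (R : realType) (L : nat) (m : routing_model R L)
    (k : option 'I_L) (t : nat) : {RV rm_prob m >-> nat} :=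
  if k is Some l then services m t l else arrivals m t.

Definition has_primitives (R : realType) (L : nat) (m : routing_model R L)
    (arr : probability nat R) (svc : 'I_L -> probability nat R) : Prop :=
  [/\ mutually_independent (rm_prob m)
        (fun k : option 'I_L => sigma_gen (fun t : nat => primitive m k t)),
      iid arr (primitive m None)
    & forall l, iid (svc l) (primitive m (Some l))].

Definition shortest (L : nat) (q : 'I_L -> nat) : {set 'I_L} :=
  [set l | [forall l', q l <= q l']%N]%SET.

Section jsq.
Context {R : realType} {L : nat} (m : routing_model R L).
Local Notation P := (rm_prob m).

Definition init_generators : set (set (rm_space m)) :=
  generators (fun l : 'I_L => queue m 0%N l).

Definition primitive_generators : set (set (rm_space m)) :=
  generators (fun kt : option 'I_L * nat => primitive m kt.1 kt.2).

(* Information generated by the initial lengths, the whole input processes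
   and the targets chosen before slot [t]; it determines the lengths at [t]. *)
Definition tie_history (target : nat -> rm_space m -> 'I_L) (t : nat)
    : set (set (rm_space m)) :=
  <<s init_generators `|` primitive_generators `|`
      generators (fun (s : 'I_t) w => nat_of_ord (target s w)) >>.

(* Given [tie_history], the target is uniform on the set of shortest queues. *)
Definition uniform_ties (target : nat -> rm_space m -> 'I_L) : Prop :=
  forall (t : nat) (l : 'I_L) (D : {set 'I_L}) (G : set (rm_space m)),
    tie_history target t G ->
    let GD := G `&` [set w | shortest (fun i => queue m t i w) = D] in
    P (GD `&` [set w | target t w = l]) =
      ((if l \in D then (#|D|%:R)^-1 else 0)%:E * P GD)%E.

Definition init_independent : Prop :=
  mutually_independent P (fun b : bool =>
    if b then <<s init_generators >> else <<s primitive_generators >>).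

Definition is_jsq : Prop :=
  init_independent /\
  exists target : nat -> rm_space m -> 'I_L,
    [/\ forall t l, measurable [set w | target t w = l],
        forall t w, target t w \in shortest (fun l => queue m t l w),
        forall t l w,
          routed m t l w = (if l == target t w then arrivals m t w else 0)%N
      & uniform_ties target].

End jsq.

Definition steady_state (R : realType) (L : nat) (m : routing_model R L)
    (X : random_vector R L) : Prop :=
  cvg_in_distribution (queue_vector m) X.

(* eps decreases to 0 inside the index set [E] of the family, for instance an
   interval ]0, eps0[ or the range of a sequence. *)
Definition heavy_traffic (R : realType) (E : set R) : set_system R :=
  within E (0 : R)^'+.

(* Main.v *)
Require Import Defs.
From mathcomp Require Import measurable_realfun ring lra.

Set Implicit Arguments.
Unset Strict Implicit.
Unset Printing Implicit Defensive.

(** Write [s] for the total length, [D] for arrivals minus offered services and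
    [U] for the unused services of a slot, so that [s' = s + D + U], [E D = - e]
    and [E D^2 = zeta + e^2].

    Lower bound: for every policy the total length dominates, path by path, a
    single-server queue started empty and fed with the pooled input.  The
    expectations of monotone functions of that queue increase in time, so its
    quadratic and cubic drifts bound its first two moments uniformly in time,
    and averaging the quadratic drift over time gives
    [2 e E s >= zeta - O(e)].

    Upper bound under JSQ: in steady state [E f = E (K f)] for the transition
    kernel [K] and all [f >= 0].  With [V = \sum_(j, k) (q_j - q_k)^2], taking
    [f = V^2] gives a bound on [E V] uniform in small [e] (state space
    collapse).  Taking [f = s^2] gives [2 e E s <= zeta + e^2 + 2 E (s' U)];
    since a queue with unused service ends empty, [s' U] is a sum of terms
    [U_k (q'_j - q'_k)], and by AM-GM with weight [sqrt e], [E U = e] and the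
    bound on [E V] its expectation is [O(sqrt e)]. *)

(** * Countably valued random variables *)

Section discernible.
Context {T : Type} {G : set (set T)} (sG : sigma_algebra setT G).

Let G0 : G set0. Proof. by case: sG. Qed.
Let GC A : G A -> G (~` A). Proof. by case: sG => _ h _ /h; rewrite setTD. Qed.
Let GU (F : (set T)^nat) : (forall n, G (F n)) -> G (\bigcup_n F n).
Proof. by case: sG => _ _; exact. Qed.

Lemma sigma_algebra_setI A B : G A -> G B -> G (A `&` B).
Proof.
move=> GA GB; rewrite -[_ `&` _]setCK setCI -bigcup2E; apply/GC/GU.
by case=> [|[|n]] /=; [exact: GC|exact: GC|exact: G0].
Qed.

Lemma sigma_algebra_setT : G setT.
Proof. by rewrite -setC0; exact: GC. Qed.

Lemma sigma_algebra_bigcap_seq (I : choiceType) (s : seq I) (F : I -> set T) :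
  (forall i, i \in s -> G (F i)) -> G (\bigcap_(i in [set` s]) F i).
Proof.
move=> GF; rewrite bigcap_seq big_seq.
by elim/big_ind: _ => //; [exact: sigma_algebra_setT|exact: sigma_algebra_setI].
Qed.

(** Measurability by fibres: it makes sense for any set system [G], in particular for
    sub-sigma-algebras given as generated set systems, and asks for no sigma-algebra on the
    codomain. For countable [C] it amounts to measurability of all preimages. *)
Definition discernible {C : Type} (X : T -> C) := forall x, G [set w | X w = x].

Lemma discernible_preimage (C : countType) (X : T -> C) (B : set C) :
  discernible X -> G (X @^-1` B).
Proof.
move=> dX.
(* [F n] is the fibre over the value with code [n] when that value lies in [B], and is empty
   otherwise; the preimage is thus a countable union. *)
pose F n := if @pickle_inv C n is Some x then
              (if `[< B x >] then [set w | X w = x] else set0) else set0.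
have -> : X @^-1` B = \bigcup_n F n.
  apply/seteqP; split => [w Bw|w [n _]].
    by exists (pickle (X w)) => //; rewrite /F pickleK_inv asboolT.
  rewrite /F; case: pickle_inv => [x|//]; case: asboolP => //= Bx Xw.
  by rewrite Xw.
apply: GU => n; rewrite /F; case: pickle_inv => [x|]; last exact: G0.
by case: asboolP => _; [exact: dX|exact: G0].
Qed.

Lemma discernible_comp (C : countType) (C' : Type) (h : C -> C') (X : T -> C) :
  discernible X -> discernible (fun w => h (X w)).
Proof. by move=> dX y; exact: (discernible_preimage [set x | h x = y] dX). Qed.

Lemma discernible_pair (C C' : Type) (X : T -> C) (X' : T -> C') :
  discernible X -> discernible X' -> discernible (fun w => (X w, X' w)).
Proof.
move=> dX dX' [x x']; have := sigma_algebra_setI (dX x) (dX' x').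
by congr G; apply/seteqP; split => w /= [-> ->].
Qed.

Lemma discernible_ffun (I : finType) (C : Type) (X : I -> T -> C) :
  (forall i, discernible (X i)) -> discernible (fun w => [ffun i => X i w]).
Proof.
move=> dX f.
have := @sigma_algebra_bigcap_seq I (enum I) (fun i => [set w | X i w = f i])
  (fun i _ => dX i (f i)).
congr G; apply/seteqP; split => w /= h.
  by apply/ffunP => i; rewrite ffunE; apply: h; rewrite /= mem_enum.
by move=> i _ /=; rewrite -h ffunE.
Qed.

Lemma discernible_cst (C : Type) (c : C) : discernible (fun=> c).
Proof.
move=> x; have [->|nx] := pselect (c = x).
  by have := sigma_algebra_setT; congr G; apply/seteqP; split.
by have := G0; congr G; apply/seteqP; split.
Qed.

End discernible.
Arguments discernible {T} G {C} X.

Section countably_valued.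
Context d (T : measurableType d) (R : realType) (P : {measure set T -> \bar R}).
Context (C : countType) (X : T -> C) (mX : discernible measurable X).
Local Open Scope ereal_scope.

Lemma measurable_fun_discernible (g : C -> \bar R) (D : set T) :
  measurable_fun D (fun w => g (X w)).
Proof.
apply: measurable_funTS => _ B _; rewrite setTI.
exact: (discernible_preimage (sigma_algebra_measurable T) (g @^-1` B) mX).
Qed.

Let fibre (A : set T) (n : nat) : set T :=
  if pickle_inv n is Some x then A `&` [set w | X w = x] else set0.

(** The fibres of [X] cut [A] into countably many pieces on which the integrand is constant, so the
    integral depends only on the measures of these pieces. *)
Lemma integral_discernible (A : set T) (g : C -> R) :
  measurable A -> (forall x, 0 <= g x)%R ->
  \int[P]_(w in A) (g (X w))%:E =
  \sum_(n <oo) (if pickle_inv n is Some x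
                then (g x)%:E * P (A `&` [set w | X w = x]) else 0).
Proof.
move=> mA g0.
have fibreA : A = \bigcup_n fibre A n.
  apply/seteqP; split => [w Aw|w [n _]]; rewrite /fibre.
    by exists (pickle (X w)) => //=; rewrite pickleK_inv.
  by case: pickle_inv => [x []|].
have mF n : measurable (fibre A n).
  rewrite /fibre; case: pickle_inv => [x|//]; exact: measurableI.
rewrite {1}fibreA ge0_integral_bigcup//; first last.
- apply/trivIsetP => i j _ _ ij; rewrite /fibre.
  have := @pickle_invK C i; have := @pickle_invK C j.
  case: pickle_inv => [y|] /=; case: pickle_inv => [x|] /=; rewrite ?setI0 ?set0I//.
  move=> yj xi; apply/seteqP; split => w //= [[_ Xx] [_ Xy]].
  by move/eqP: ij; apply; rewrite -xi -yj -Xx -Xy.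
- by move=> w _; rewrite lee_fin.
- exact: (measurable_fun_discernible (fun x => (g x)%:E)).
apply: eq_eseriesr => n _; rewrite /fibre; case: pickle_inv => [x|]; last first.
  by rewrite integral_set0.
rewrite -integral_cst; last by apply: measurableI => //; exact: mX.
by apply: eq_integral => w; rewrite inE => -[_ /= ->].
Qed.

(** This replaces conditional expectation given [X]: if, on each fibre, the measure of [A] is a
    factor depending on the value times that of [B], the factor may be moved under the integral. *)
Lemma eq_integral_fibres (A B : set T) (g c : C -> R) :
  measurable A -> measurable B ->
  (forall x, 0 <= g x)%R -> (forall x, 0 <= c x)%R ->
  (forall x, P (A `&` [set w | X w = x]) =
             (c x)%:E * P (B `&` [set w | X w = x])) ->
  \int[P]_(w in A) (g (X w))%:E = \int[P]_(w in B) (g (X w) * c (X w))%:E.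
Proof.
move=> mA mB g0 c0 AB; rewrite integral_discernible//.
rewrite (@integral_discernible B (fun x => g x * c x)%R)//; last first.
  by move=> x; exact: mulr_ge0.
apply: eq_eseriesr => n _; case: pickle_inv => [x|//].
by rewrite AB EFinM muleA.
Qed.

End countably_valued.

(** * Chains driven by independent inputs *)

Section cylinder.
Context {T : Type} {Z : eqType} (Y : nat -> T -> Z).

(** The event that the inputs of the slots [t], [t + 1], ... are the successive entries of [ys]. *)
Fixpoint cylinder (ys : seq Z) (t : nat) : set T :=
  if ys is z :: zs then [set w | Y t w = z] `&` cylinder zs t.+1 else setT.

Lemma sigma_algebra_cylinder (G : set (set T)) ys t : sigma_algebra setT G ->
  (forall t, discernible G (Y t)) -> G (cylinder ys t).
Proof.
move=> sG dY; elim: ys t => [|z zs IH] t /=; first exact: sigma_algebra_setT.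
by apply: sigma_algebra_setI => //; exact: dY.
Qed.

Lemma cylinderE z0 ys t : cylinder ys t =
  \bigcap_(i in [set` iota 0 (size ys)]) [set w | Y (t + i)%N w = nth z0 ys i].
Proof.
elim: ys t => [|z zs IH] t; first by rewrite set_nil bigcap_set0.
rewrite bigcap_seq /= big_cons addn0 /=; congr (_ `&` _).
rewrite IH bigcap_seq -(addn0 1%N) iotaDl big_map.
by apply: eq_bigr => i _; rewrite addSnnS.
Qed.

End cylinder.

Section driven_chain.
Context d (T : measurableType d) (R : realType) (P : probability T R).
Context (C : countType) (Z Tg : finType).
Context (X : nat -> T -> C) (Y : nat -> T -> Z) (tg : nat -> T -> Tg).
Context (p : Z -> R) (c : C -> Tg -> R) (step : C -> Tg -> Z -> C).
Local Open Scope ereal_scope.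

Definition kernel_of (g : C -> R) (x : C) : R :=
  (\sum_l \sum_z c x l * p z * g (step x l z))%R.

Context (p0 : forall z, (0 <= p z)%R) (c0 : forall x l, (0 <= c x l)%R).
Context (mX : forall t, discernible measurable (X t))
        (mY : forall t, discernible measurable (Y t))
        (mtg : forall t, discernible measurable (tg t)).
(* The tag is drawn from its weights given the present state, independently of
   all present and future inputs. *)
Context (Ptg : forall t x l ys,
  P ([set w | X t w = x] `&` cylinder Y ys t `&` [set w | tg t w = l]) =
  (c x l)%:E * P ([set w | X t w = x] `&` cylinder Y ys t)).
Context (PX0 : forall x ys,
  P ([set w | X 0%N w = x] `&` cylinder Y ys 0) =
  P [set w | X 0%N w = x] * (\prod_(z <- ys) p z)%:E).
Context (Xstep : forall t, {ae P, forall w,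
  X t.+1 w = step (X t w) (tg t w) (Y t w)}).

Lemma kernel_of_ge0 g x : (forall x, 0 <= g x)%R -> (0 <= kernel_of g x)%R.
Proof.
move=> g0; apply: sumr_ge0 => l _; apply: sumr_ge0 => z _.
by rewrite !mulr_ge0.
Qed.

Let measurable_cylinder ys t : measurable (cylinder Y ys t).
Proof. exact: (sigma_algebra_cylinder ys t (sigma_algebra_measurable T) mY). Qed.

Let prod_ge0 ys : (0 <= \prod_(z <- ys) p z)%R.
Proof. exact: prodr_ge0. Qed.

(** Independence of the state at [t] from the inputs from slot [t] on, phrased with integrals so
    that it can be proved by induction together with the transition identity. *)
Let independent_of_future t := forall (g : C -> R) ys, (forall x, 0 <= g x)%R ->
  \int[P]_(w in cylinder Y ys t) (g (X t w))%:E =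
  (\prod_(z <- ys) p z)%:E * \int[P]_w (g (X t w))%:E.

Let mgX t (g : C -> R) D : measurable_fun D (fun w => (g (X t w))%:E).
Proof. exact: (@measurable_fun_discernible _ _ _ _ _ (mX t) (fun x => (g x)%:E)). Qed.

(** The cylinder is split by the tag and the input of slot [t]. On each piece the tag contributes
    its weight, by [Ptg], and the input and the future factor out, by [independent_of_future]. Empty
    [ys] gives the transition identity; general [ys] carries independence on to the next slot. *)
Let one_step t ys g : independent_of_future t -> (forall x, 0 <= g x)%R ->
  \int[P]_(w in cylinder Y ys t.+1) (g (X t.+1 w))%:E =
  (\prod_(z <- ys) p z)%:E * \int[P]_w (kernel_of g (X t w))%:E.
Proof.
move=> It g0.
pose XYt w := (X t w, (tg t w, Y t w)).
have mXYt : discernible measurable XYt.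
  by do 2![apply: (discernible_pair (sigma_algebra_measurable T)) => //].
(* The recursion holds almost surely only, because inputs are clamped; the integral does not
   notice. *)
have -> : \int[P]_(w in cylinder Y ys t.+1) (g (X t.+1 w))%:E =
    \int[P]_(w in cylinder Y ys t.+1) (g (step (X t w) (tg t w) (Y t w)))%:E.
  apply: ge0_ae_eq_integral.
  - exact: measurable_cylinder.
  - exact: mgX.
  - exact: (@measurable_fun_discernible _ _ _ _ _ mXYt
      (fun u => (g (step u.1 u.2.1 u.2.2))%:E)).
  - by move=> w _; rewrite lee_fin.
  - by move=> w _; rewrite lee_fin.
  - by apply: filterS (Xstep t) => w -> _.
(* The piece on which slot [t] has tag [u.1] and input [u.2], followed by the inputs [ys]. *)
pose F (u : Tg * Z) := cylinder Y (u.2 :: ys) t `&` [set w | tg t w = u.1].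
have mF u : measurable (F u).
  by apply: measurableI; [exact: measurable_cylinder|exact: mtg].
have FE : cylinder Y ys t.+1 = \big[setU/set0]_(u <- enum {: Tg * Z}) F u.
  rewrite -bigcup_seq; apply/seteqP; split => [w ysw|w [u _] [[]]//].
  by exists (tg t w, Y t w); rewrite /= ?mem_enum//.
rewrite FE ge0_integral_bigsetU//; first last.
- by move=> w _; rewrite lee_fin.
- exact: (@measurable_fun_discernible _ _ _ _ _ mXYt
    (fun u => (g (step u.1 u.2.1 u.2.2))%:E)).
- apply/trivIsetP => u v _ _ uv; apply/seteqP; split => w //=.
  move=> [[[/= Yu _] /= tu] [[/= Yv _] /= tv]].
  by move/eqP: uv; apply; case: u v Yu tu Yv tv => [? ?] [? ?] /= <- <- <- <-.
- exact: enum_uniq.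
have intF u : \int[P]_(w in F u) (g (step (X t w) (tg t w) (Y t w)))%:E =
    (\prod_(z <- u.2 :: ys) p z)%:E *
    \int[P]_w (g (step (X t w) u.1 u.2) * c (X t w) u.1)%:E.
  have -> : \int[P]_(w in F u) (g (step (X t w) (tg t w) (Y t w)))%:E =
            \int[P]_(w in F u) (g (step (X t w) u.1 u.2))%:E.
    by apply: eq_integral => w; rewrite inE => -[[/= -> _] ->].
  rewrite (@eq_integral_fibres _ _ _ _ _ _ (mX t) (F u) (cylinder Y (u.2 :: ys) t)
    (fun x => g (step x u.1 u.2)) (fun x => c x u.1)) => //; first last.
  - move=> x; rewrite (setIC (cylinder _ _ _) [set w | _ ]) -Ptg; congr (P _).
    by rewrite /F setIAC (setIC (cylinder _ _ _) [set w | _ ]).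
  rewrite (It (fun x => g (step x u.1 u.2) * c x u.1)%R) //.
  by move=> x; rewrite mulr_ge0.
rewrite (eq_bigr _ (fun u _ => intF u)).
have KE w : (kernel_of g (X t w))%:E =
    \sum_(u <- enum {: Tg * Z})
      ((p u.2)%:E * (g (step (X t w) u.1 u.2) * c (X t w) u.1)%:E).
  rewrite /kernel_of pair_big/= sumEFin -big_enum/=; congr EFin.
  by apply: eq_bigr => u _ /=; ring.
under [in RHS]eq_integral do rewrite KE.
rewrite ge0_integral_sum//; first last.
- by move=> u w _; rewrite -EFinM lee_fin !mulr_ge0.
- move=> u; exact: (@measurable_fun_discernible _ _ _ _ _ (mX t)
    (fun x => ((p u.2)%:E * (g (step x u.1 u.2) * c x u.1)%:E))).
rewrite ge0_sume_distrr; last first.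
  move=> u _; apply: integral_ge0 => w _; by rewrite -EFinM lee_fin !mulr_ge0.
apply: eq_bigr => u _; rewrite big_cons ge0_integralZl_EFin//.
- by rewrite muleA -EFinM mulrC.
- by move=> w _; rewrite lee_fin mulr_ge0.
- exact: (@mgX t (fun x => g (step x u.1 u.2) * c x u.1)%R).
Qed.

Let indep t : independent_of_future t.
Proof.
elim: t => [|t IH] g ys g0.
  rewrite (@eq_integral_fibres _ _ _ _ _ _ (mX 0) (cylinder Y ys 0) setT
    g (fun=> \prod_(z <- ys) p z)%R)//; first last.
  - by move=> x; rewrite setTI muleC -PX0 setIC.
  under eq_integral do rewrite mulrC EFinM.
  by rewrite ge0_integralZl_EFin// => w _; rewrite lee_fin.
rewrite one_step//; congr (_ * _).
by have := one_step [::] IH g0; rewrite /= big_nil mul1e.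
Qed.

Lemma chain_expect t (g : C -> R) : (forall x, 0 <= g x)%R ->
  \int[P]_w (g (X t.+1 w))%:E = \int[P]_w (kernel_of g (X t w))%:E.
Proof.
by move=> g0; have := one_step [::] (@indep t) g0; rewrite /= big_nil mul1e.
Qed.

End driven_chain.

Lemma big_option_split (V : nmodType) (I : finType) (F : option I -> V) :
  \sum_k F k = F None + \sum_i F (Some i).
Proof.
rewrite (bigD1 None)//=; congr (_ + _).
rewrite (reindex_omap Some id)/=; last by case.
by apply: eq_bigl => i; rewrite eqxx.
Qed.

(** * The law of the inputs of one slot *)

(* Clamping the inputs at their almost sure bound makes the space of inputs of
   one slot finite, so that transition kernels are finite sums. *)
Definition clamp (B n : nat) : 'I_B.+1 := inord (minn n B).

Lemma clampE B n : (clamp B n : nat) = minn n B.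
Proof. by rewrite /clamp inordK// ltnS geq_minr. Qed.

Lemma clamp_small B n : (n <= B)%N -> clamp B n = n :> nat.
Proof. by move=> nB; rewrite clampE; apply/minn_idPl. Qed.

Section clamped_law.
Context {R : realType} (B : nat) (m : probability nat R).

Definition weight (j : 'I_B.+1) : R := fine (m [set n | clamp B n = j]).

Lemma weightE j : m [set n | clamp B n = j] = (weight j)%:E.
Proof. by rewrite fineK// fin_num_measure. Qed.

Lemma weight_ge0 j : 0 <= weight j.
Proof. exact: fine_ge0. Qed.

Lemma clamped_integral (g : 'I_B.+1 -> R) : (forall j, 0 <= g j) ->
  (\int[m]_n (g (clamp B n))%:E = (\sum_j weight j * g j)%:E)%E.
Proof.
move=> g0.
have clampT : [set: nat] = \big[setU/set0]_(j <- enum 'I_B.+1) [set n | clamp B n = j].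
  rewrite -bigcup_seq; apply/seteqP; split => // n _.
  by exists (clamp B n); rewrite //= mem_enum.
rewrite clampT ge0_integral_bigsetU//.
- rewrite big_enum /= -sumEFin; apply: eq_bigr => j _.
  rewrite EFinM muleC -weightE -integral_cst//.
  by apply: eq_integral => n; rewrite inE /= => ->.
- exact: enum_uniq.
- apply/trivIsetP => i j _ _ /eqP ij; apply/seteqP; split => // n /= [ni nj].
  by apply: ij; rewrite -ni.
- by move=> n _; rewrite lee_fin.
Qed.

Lemma sum_weight : \sum_j weight j = 1.
Proof.
have := @clamped_integral (fun=> 1) (fun=> ler01).
rewrite integral_cst// mul1e.
rewrite [X in X = _](probability_setT m) => -[->].
by under [RHS]eq_bigr do rewrite mulr1.
Qed.

Context (M : nat) (MB : (M <= B)%N) (mM : bounded_law m M).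

Lemma bounded_law_ae : {ae m, forall n, (n <= M)%N}.
Proof.
exists [set n | ~ (n <= M)%N]; split => //.
rewrite (_ : [set n | _] = ~` [set n | (n <= M)%N])//.
by rewrite probability_setC// mM subee.
Qed.

(** Clamping at a level above the almost sure bound changes the variable on a null set only, so the
    integral is the finite sum over clamped values. *)
Lemma bounded_integral (g : nat -> R) : (forall j, 0 <= g j) ->
  (\int[m]_n (g n)%:E = (\sum_j weight j * g j)%:E)%E.
Proof.
move=> g0; rewrite -(clamped_integral (g := g))//.
apply: ge0_ae_eq_integral => //.
- by move=> n _; rewrite lee_fin.
- by move=> n _; rewrite lee_fin.
- apply: filterS bounded_law_ae => n nM _ /=.
  by rewrite clamp_small// (leq_trans nM).
Qed.

Lemma law_mean_weight : law_mean m = \sum_j weight j * j%:R.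
Proof.
by rewrite /law_mean expectation.unlock (bounded_integral (g := fun n => n%:R))//.
Qed.

Lemma law_var_weight :
  law_var m = \sum_j weight j * (j%:R - law_mean m) ^+ 2.
Proof.
rewrite /law_var /variance covariance.unlock -/(law_mean m).
rewrite (_ : _ * _ = (fun n : nat => (n%:R - law_mean m) ^+ 2)); last first.
  by apply/funext => n; rewrite expr2.
rewrite expectation.unlock.
rewrite (bounded_integral (g := fun n => (n%:R - law_mean m) ^+ 2))// => j.
exact: sqr_ge0.
Qed.

End clamped_law.

Section input_law.
Context {R : realType} {K : finType} (B : nat) (law : K -> probability nat R).

Local Notation input := {ffun K -> 'I_B.+1}.

Definition input_weight (z : input) : R := \prod_k weight (law k) (z k).

Definition input_mean (g : input -> R) : R := \sum_z input_weight z * g z.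

Lemma input_weight_ge0 z : 0 <= input_weight z.
Proof. by apply: prodr_ge0 => k _; exact: weight_ge0. Qed.

(** Independence of the coordinates of one slot, here as distributivity of the product over the
    sums. Marginals and pairs of coordinates follow by taking all other factors equal to 1. *)
Lemma input_mean_prod (f : K -> 'I_B.+1 -> R) :
  input_mean (fun z => \prod_k f k (z k)) =
  \prod_k \sum_j weight (law k) j * f k j.
Proof. by rewrite bigA_distr_bigA; apply: eq_bigr => z _; rewrite -big_split. Qed.

Lemma sum_input_weight : \sum_z input_weight z = 1.
Proof.
transitivity (\prod_k \sum_j weight (law k) (j : 'I_B.+1)).
  by rewrite bigA_distr_bigA.
by apply: big1 => k _; exact: sum_weight.
Qed.

Lemma input_mean_cst (a : R) : input_mean (fun=> a) = a.
Proof. by rewrite /input_mean -mulr_suml sum_input_weight mul1r. Qed.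

Lemma input_meanD f g :
  input_mean (fun z => f z + g z) = input_mean f + input_mean g.
Proof. by rewrite /input_mean -big_split; apply: eq_bigr => z _; rewrite mulrDr. Qed.

Lemma input_meanZ a f : input_mean (fun z => a * f z) = a * input_mean f.
Proof. by rewrite /input_mean mulr_sumr; apply: eq_bigr => z _; rewrite mulrCA. Qed.

Lemma input_mean_sum (I : finType) (f : I -> input -> R) :
  input_mean (fun z => \sum_i f i z) = \sum_i input_mean (f i).
Proof.
rewrite /input_mean exchange_big/=; apply: eq_bigr => z _.
by rewrite mulr_sumr.
Qed.

Lemma le_input_mean f g : (forall z, f z <= g z) -> input_mean f <= input_mean g.
Proof.
by move=> fg; apply: ler_sum => z _; rewrite ler_wpM2l// input_weight_ge0.
Qed.

Lemma eq_input_mean f g : (forall z, f z = g z) -> input_mean f = input_mean g.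
Proof. by move=> fg; apply: eq_bigr => z _; rewrite fg. Qed.

Lemma input_mean_coord k (g : 'I_B.+1 -> R) :
  input_mean (fun z => g (z k)) = \sum_j weight (law k) j * g j.
Proof.
pose f k' j := if k' == k then g j else 1.
transitivity (input_mean (fun z => \prod_k' f k' (z k'))).
  apply: eq_input_mean => z; rewrite (bigD1 k)//= /f eqxx big1 ?mulr1// => i.
  by move=> /negbTE ->.
rewrite input_mean_prod (bigD1 k)//= [X in _ * X]big1 ?mulr1.
  by apply: eq_bigr => j _; rewrite /f eqxx.
move=> i /negbTE ik; under eq_bigr do rewrite /f ik mulr1.
exact: sum_weight.
Qed.

Lemma input_mean_coord2 k l (g h : 'I_B.+1 -> R) : k != l ->
  input_mean (fun z => g (z k) * h (z l)) =
  (\sum_j weight (law k) j * g j) * (\sum_j weight (law l) j * h j).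
Proof.
move=> kl.
pose f k' j := if k' == k then g j else if k' == l then h j else 1.
have lk : (l == k) = false by rewrite eq_sym (negbTE kl).
transitivity (input_mean (fun z => \prod_k' f k' (z k'))).
  apply: eq_input_mean => z; rewrite (bigD1 k)//= (bigD1 l)//= ?lk//.
  rewrite /f !eqxx lk big1 ?mulr1// => i.
  by move=> /andP[/negbTE -> /negbTE ->].
rewrite input_mean_prod (bigD1 k)//= (bigD1 l)//= ?lk//.
rewrite [X in _ * (_ * X)]big1 ?mulr1.
  by congr (_ * _); apply: eq_bigr => j _; rewrite /f ?eqxx ?lk.
move=> i /andP[/negbTE ik /negbTE il].
by under eq_bigr do rewrite /f ik il mulr1; exact: sum_weight.
Qed.

Context (bnd : forall k, exists2 M, (M <= B)%N & bounded_law (law k) M).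

Lemma input_mean_linear (a : K -> R) :
  input_mean (fun z => \sum_k a k * (z k)%:R) = \sum_k a k * law_mean (law k).
Proof.
rewrite input_mean_sum; apply: eq_bigr => k _.
rewrite input_meanZ (input_mean_coord k (fun j => j%:R)).
by have [M MB bM] := bnd k; rewrite (law_mean_weight MB bM).
Qed.

(** After expansion of the square, the cross terms vanish because distinct coordinates are
    independent and centred; the diagonal gives the variances. *)
Lemma input_mean_centred_sqr (a : K -> R) :
  input_mean (fun z => (\sum_k a k * ((z k)%:R - law_mean (law k))) ^+ 2) =
  \sum_k a k ^+ 2 * law_var (law k).
Proof.
have centred k : \sum_j weight (law k) j * ((j : 'I_B.+1)%:R - law_mean (law k)) = 0.
  under eq_bigr do rewrite mulrBr.
  have [M MB bM] := bnd k.
  by rewrite sumrB -mulr_suml sum_weight mul1r -(law_mean_weight MB bM) subrr.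
transitivity (input_mean (fun z => \sum_k \sum_l
    a k * a l * (((z k)%:R - law_mean (law k)) * ((z l)%:R - law_mean (law l))))).
  apply: eq_input_mean => z; rewrite expr2 mulr_suml; apply: eq_bigr => k _.
  by rewrite mulr_sumr; apply: eq_bigr => l _; ring.
rewrite input_mean_sum; apply: eq_bigr => k _.
rewrite input_mean_sum (bigD1 k)//= [X in _ + X]big1 ?addr0.
  rewrite input_meanZ -expr2; congr (_ * _).
  rewrite (input_mean_coord k
    (fun j => (j%:R - law_mean (law k)) * (j%:R - law_mean (law k)))).
  have [M MB bM] := bnd k; rewrite (law_var_weight MB bM).
  by apply: eq_bigr => j _; rewrite expr2.
move=> l lk; rewrite input_meanZ.
rewrite (@input_mean_coord2 k l (fun j => j%:R - law_mean (law k))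
  (fun j => j%:R - law_mean (law l))) 1?eq_sym//.
by rewrite centred mul0r mulr0.
Qed.

End input_law.

Definition clamped {T : Type} {K : finType} (B : nat) (prim : K -> nat -> T -> nat)
    (t : nat) (w : T) : {ffun K -> 'I_B.+1} :=
  [ffun k => clamp B (prim k t w)].

Lemma discernible_clamped (T : Type) (K : finType) (B : nat)
    (prim : K -> nat -> T -> nat) (G : set (set T)) t : sigma_algebra setT G ->
  (forall k, discernible G (prim k t)) -> discernible G (clamped B prim t).
Proof.
move=> sG dprim; apply: (discernible_ffun sG) => k.
exact: (discernible_comp sG (clamp B) (dprim k)).
Qed.

Lemma sigma_algebra_gen (T : Type) (F : set (set T)) : sigma_algebra setT <<s F >>.
Proof. exact: smallest_sigma_algebra. Qed.

Lemma discernible_gen d (T : measurableType d) (I : Type)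
    (X : I -> T -> nat) (F : set (set T)) i :
  generators X `<=` F -> discernible <<s F >> (X i).
Proof.
move=> XF n; apply: sub_gen_smallest; apply: XF; exists i => //.
by exists [set n] => //=; rewrite setTI.
Qed.

Lemma discernible_RV d (T : measurableType d) (R : realType)
  (P : probability T R) (X : {RV P >-> nat}) : discernible measurable X.
Proof. by move=> n; exact: (measurable_funPTI X (Y := [set n])). Qed.

(** * The joint law of the inputs of a routing model *)

Section independent_inputs.
Context d (T : measurableType d) (R : realType) (P : probability T R).
Context (K : finType) (prim : K -> nat -> {RV P >-> nat}).
Context (law : K -> probability nat R) (B : nat).
Hypothesis indep : mutually_independent P
  (fun k => sigma_gen (fun t : nat => prim k t)).
Hypothesis iid_prim : forall k, iid (law k) (prim k).

Let Y := clamped B (fun k t => prim k t : T -> nat).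

(** Independence is used twice: across the processes for the outer intersection, then across the
    slots of each process; the two products are finally exchanged. *)
Lemma prob_cylinder (ys : seq {ffun K -> 'I_B.+1}) :
  P (cylinder Y ys 0) = (\prod_(z <- ys) input_weight law z)%:E.
Proof.
pose z0 : {ffun K -> 'I_B.+1} := [ffun => ord0].
pose A k i := [set w | clamp B (prim k i w) = nth z0 ys i k].
pose Bk k := \bigcap_(i in [set` iota 0 (size ys)]) A k i.
have cylE : cylinder Y ys 0 = \bigcap_(k in [set` enum K]) Bk k.
  rewrite (cylinderE _ z0); apply/seteqP; split => w /= h.
    move=> k _ i ii; have := h i ii; rewrite add0n => /ffunP /(_ k).
    by rewrite ffunE.
  move=> i ii; rewrite add0n; apply/ffunP => k; rewrite ffunE.
  by apply: (h k _ i ii); rewrite /= mem_enum.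
rewrite cylE indep ?enum_uniq//; last first.
  move=> k _; apply: (sigma_algebra_bigcap_seq (sigma_algebra_gen _)) => i _.
  apply: sub_gen_smallest; exists i => //.
  by exists [set n | clamp B n = nth z0 ys i k] => //=; rewrite setTI.
have PBk k : P (Bk k) = (\prod_(z <- ys) weight (law k) (z k))%:E.
  have [indk lawk] := iid_prim k.
  rewrite indk ?iota_uniq//; last first.
    move=> i _; apply: sub_gen_smallest; exists tt => //.
    by exists [set n | clamp B n = nth z0 ys i k] => //=; rewrite setTI.
  rewrite (big_nth z0) -prodEFin /index_iota subn0; apply: eq_bigr => i _.
  by rewrite -weightE -(lawk i).
rewrite (eq_bigr _ (fun k _ => PBk k)).
by rewrite prodEFin exchange_big/=; under eq_bigr do rewrite big_enum/=.
Qed.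

End independent_inputs.

Section routing.
Context {R : realType} {L : nat}.

Definition input_law (arr : probability nat R) (svc : 'I_L -> probability nat R)
    (k : option 'I_L) : probability nat R :=
  if k is Some l then svc l else arr.

Definition model_input (B : nat) (m : routing_model R L) :=
  clamped B (fun k t => primitive m k t : rm_space m -> nat).
Arguments model_input B m : clear implicits.

Context (m : routing_model R L) (arr : probability nat R).
Context (svc : 'I_L -> probability nat R) (Amax Smax : nat).
Hypothesis Hprim : has_primitives m arr svc.
Hypothesis Harr : bounded_law arr Amax.
Hypothesis Hsvc : forall l, bounded_law (svc l) Smax.
Let B := maxn Amax Smax.

Lemma input_law_bounded k :
  exists2 M, (M <= B)%N & bounded_law (input_law arr svc k) M.
Proof.
case: k => [l|]; [exists Smax|exists Amax] => //.
- exact: leq_maxr.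
- exact: Hsvc.
- exact: leq_maxl.
Qed.

Lemma input_law_iid k : iid (input_law arr svc k) (primitive m k).
Proof. by case: Hprim => _ iidA iidS; case: k => [l|]; [exact: iidS|exact: iidA]. Qed.

Lemma prob_model_cylinder ys : rm_prob m (cylinder (model_input B m) ys 0) =
  (\prod_(z <- ys) input_weight (input_law arr svc) z)%:E.
Proof.
by case: Hprim => ind _ _; exact: prob_cylinder ind input_law_iid _.
Qed.

Lemma primitive_small t :
  {ae rm_prob m, forall w, forall k, (primitive m k t w <= B)%N}.
Proof.
have bad k : rm_prob m [set w | ~ (primitive m k t w <= B)%N] = 0%E.
  have [_ lawk] := input_law_iid k; have [M MB bM] := input_law_bounded k.
  have [N [mN N0 subN]] := bounded_law_ae bM.
  apply/eqP; rewrite -measure_le0; rewrite -N0 -(lawk t).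
  apply: le_measure; rewrite ?inE.
  - have /(discernible_preimage (sigma_algebra_measurable _)
      [set n | ~ (n <= B)%N]) := discernible_RV (primitive m k t).
    exact.
  - exact: measurable_funPTI.
  - move=> w /= wB; apply: subN => /= wM; apply: wB.
    exact: leq_trans wM MB.
exists (\big[setU/set0]_(k <- enum {: option 'I_L})
  [set w | ~ (primitive m k t w <= B)%N]).
have mbad k : measurable [set w | ~ (primitive m k t w <= B)%N].
  have /(discernible_preimage (sigma_algebra_measurable _)
      [set n | ~ (n <= B)%N]) := discernible_RV (primitive m k t).
  exact.
split.
- by apply: bigsetU_measurable.
- elim: (enum _) => [|k s IH]; first by rewrite big_nil measure0.
  rewrite big_cons; apply: null_set_setU => //; last exact: bad.
  exact: bigsetU_measurable.
- move=> w /= /existsNP[k kB]; rewrite -bigcup_seq.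
  by exists k; rewrite /= ?mem_enum.
Qed.

End routing.

(** * One slot of the queues under JSQ *)

Section positive_part.
Context {R : realType}.
Implicit Types n a s : nat.

(** The service wasted in a slot by a queue of length [n] with [a] arrivals and offered service [s]:
    the correction made by the positive part. *)
Definition unused n a s : R := (n + a - s)%N%:R - (n%:R + a%:R - s%:R).

Lemma unused_cases n a s :
  ((n + a - s)%N%:R = n%:R + a%:R - s%:R :> R /\ unused n a s = 0) \/
  ((n + a - s)%N%:R = 0 :> R /\ unused n a s = s%:R - n%:R - a%:R /\
   n%:R + a%:R <= s%:R :> R).
Proof.
rewrite /unused; case: (leqP s (n + a)%N) => h; [left|right].
  by rewrite natrB// natrD subrr.
have /eqP -> : (n + a - s == 0)%N by rewrite subn_eq0 ltnW.
by rewrite -natrD ler_nat (ltnW h); split => //; split => //; rewrite natrD; ring.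
Qed.

Lemma unused_ge0 n a s : 0 <= unused n a s.
Proof. by case: (unused_cases n a s) => [[_ ->]|[_ []]]//; lra. Qed.

Lemma unused_le n a s : unused n a s <= s%:R.
Proof.
have := ler0n R n; have := ler0n R a; have := ler0n R s.
by case: (unused_cases n a s) => [[_ ->]|[_ []]]//; lra.
Qed.

Lemma unused_mul n a s : (n + a - s)%N%:R * unused n a s = 0.
Proof. by case: (unused_cases n a s) => [[_ ->]|[-> _]]; rewrite ?mulr0 ?mul0r. Qed.

Lemma positive_part_sqr n a s :
  (n + a - s)%N%:R ^+ 2 <= (n%:R + a%:R - s%:R) ^+ 2 :> R.
Proof.
case: (unused_cases n a s) => [[-> _]|[-> _]]//.
by rewrite expr0n sqr_ge0.
Qed.

Lemma positive_part_dist n a s B : (a <= B)%N -> (s <= B)%N ->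
  `|(n + a - s)%N%:R - n%:R| <= B%:R :> R.
Proof.
rewrite -!(ler_nat R) => aB sB; have := ler0n R n; have := ler0n R a.
have := ler0n R s; rewrite ler_norml.
by case: (unused_cases n a s) => [[-> _]|[-> [_]]]; lra.
Qed.

End positive_part.

(** Cauchy-Schwarz against the constant 1, read off from the nonnegative sum of all squared
    differences. *)
Lemma sqr_sum_le (R : realType) (I : finType) (f : I -> R) :
  (\sum_i f i) ^+ 2 <= #|I|%:R * \sum_i f i ^+ 2.
Proof.
have : 0 <= \sum_i \sum_j (f i - f j) ^+ 2.
  by apply: sumr_ge0 => i _; apply: sumr_ge0 => j _; exact: sqr_ge0.
have -> : \sum_i \sum_j (f i - f j) ^+ 2 =
    2 * (#|I|%:R * \sum_i f i ^+ 2) - 2 * (\sum_i f i) ^+ 2.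
  transitivity (\sum_i (#|I|%:R * f i ^+ 2 + \sum_j f j ^+ 2
     - 2 * (f i * \sum_j f j))).
    apply: eq_bigr => i _; rewrite !mulr_sumr mulr_natl -sumr_const.
    rewrite -big_split -sumrB; apply: eq_bigr => j _ /=; ring.
  rewrite sumrB big_split/= -mulr_sumr sumr_const -mulr_sumr -mulr_suml.
  by rewrite -[_ *+ _]mulr_natl; ring.
lra.
Qed.

Lemma sum_ord_cst (R : realType) (n : nat) (a : R) : \sum_(i < n) a = n%:R * a.
Proof. by rewrite sumr_const card_ord mulr_natl. Qed.

Section spread.
Context {R : realType} {L : nat}.
Implicit Types (q : {ffun 'I_L -> nat}).

Definition total q : R := \sum_k (q k)%:R.
(** Equal to [2 * L] times the squared Euclidean distance from [q] to the line of equal queue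
    lengths; bounding its mean is state space collapse. *)
Definition spread q : R := \sum_j \sum_k ((q j)%:R - (q k)%:R) ^+ 2.

Lemma total_ge0 q : 0 <= total q.
Proof. exact: sumr_ge0. Qed.

Lemma spread_ge0 q : 0 <= spread q.
Proof. by apply: sumr_ge0 => j _; apply: sumr_ge0 => k _; exact: sqr_ge0. Qed.

Lemma spreadE q : spread q = 2 * (L%:R * \sum_k (q k)%:R ^+ 2) - 2 * total q ^+ 2.
Proof.
transitivity (\sum_j (L%:R * (q j)%:R ^+ 2 + \sum_k (q k)%:R ^+ 2
     - 2 * ((q j)%:R * total q))).
  apply: eq_bigr => j _; rewrite !mulr_sumr -sum_ord_cst.
  by rewrite -big_split -sumrB; apply: eq_bigr => k _ /=; ring.
rewrite sumrB big_split/= -mulr_sumr sum_ord_cst -mulr_sumr -mulr_suml.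
by rewrite /total; ring.
Qed.

Lemma shortestP q l k : l \in shortest q -> (q l)%:R <= (q k)%:R :> R.
Proof. by rewrite inE => /forallP/(_ k); rewrite ler_nat. Qed.

(** For a shortest queue [l] this is the total length in excess of [L] copies of the minimum; the
    negative drift of [spread] is proportional to it. *)
Definition excess q l : R := \sum_k ((q k)%:R - (q l)%:R).

Lemma excess_ge0 q l : l \in shortest q -> 0 <= excess q l.
Proof. by move=> ql; apply: sumr_ge0 => k _; rewrite subr_ge0 shortestP. Qed.

(** Lengths measured from the shortest queue are nonnegative and sum to [excess q l], so each
    pairwise difference is at most [excess q l] in absolute value. *)
Lemma spread_le_excess q l : l \in shortest q ->
  spread q <= L%:R ^+ 2 * excess q l ^+ 2.
Proof.
move=> ql.
have le_excess k : (q k)%:R - (q l)%:R <= excess q l.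
  rewrite /excess (bigD1 k)//= lerDl; apply: sumr_ge0 => j _.
  by rewrite subr_ge0 shortestP.
rewrite (expr2 L%:R) -mulrA -sum_ord_cst; apply: ler_sum => j _.
rewrite -sum_ord_cst; apply: ler_sum => k _.
rewrite -real_normK ?num_real// lerXn2r ?nnegrE ?excess_ge0//.
have := le_excess j; have := le_excess k.
have := shortestP j ql; have := shortestP k ql.
by rewrite ler_norml; lra.
Qed.

Context (B : nat).
Implicit Types (z : {ffun option 'I_L -> 'I_B.+1}).

Definition jsq_step q l z : {ffun 'I_L -> nat} :=
  [ffun k => (q k + (if k == l then z None : nat else 0) - z (Some k))%N].

Definition net_input z : R := (z None)%:R - \sum_k (z (Some k))%:R.

Let U q l z k : R := unused (q k) (if k == l then z None : nat else 0) (z (Some k)).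

Let arrival_le (k l : 'I_L) z : ((if k == l then z None : nat else 0) <= B)%N.
Proof. by case: ifP => // _; exact: leq_ord. Qed.

Let U_le q l z k : U q l z k <= B%:R.
Proof. by apply: le_trans (unused_le _ _ _) _; rewrite ler_nat leq_ord. Qed.

Let sum_arrival (l : 'I_L) z :
  \sum_k (if k == l then z None : nat else 0)%N%:R = (z None)%:R :> R.
Proof.
by rewrite (bigD1 l)//= eqxx big1 ?addr0// => k /negbTE ->.
Qed.

Lemma total_step q l z :
  total (jsq_step q l z) - total q - net_input z = \sum_k U q l z k.
Proof.
rewrite /U /unused sumrB; under [X in _ = X - _]eq_bigr do
  rewrite -[X in X%:R](ffunE (fun k =>
    (q k + (if k == l then z None : nat else 0) - z (Some k))%N)).
by rewrite -/(total _) sumrB big_split/= sum_arrival /net_input /total; ring.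
Qed.

Lemma total_step_ge0 q l z : 0 <= total (jsq_step q l z) - total q - net_input z.
Proof. by rewrite total_step; apply: sumr_ge0 => k _; exact: unused_ge0. Qed.

Lemma total_step_sqr_le q l z eta : 0 < eta ->
  total (jsq_step q l z) ^+ 2 <= (total q + net_input z) ^+ 2
    + eta * spread (jsq_step q l z)
    + L%:R * B%:R / eta * (total (jsq_step q l z) - total q - net_input z).
Proof.
move=> eta0; set q' := jsq_step q l z.
set W := total q' - _ - _.
have WE : W = \sum_k U q l z k by exact: total_step.
have -> : total q + net_input z = total q' - W by rewrite /W; ring.
have W2 : 0 <= W ^+ 2 by exact: sqr_ge0.
(* A queue with unused service ends the slot empty, so its own length can be
   subtracted from the total. *)
suff : 2 * (total q' * W) <= eta * spread q' + L%:R * B%:R / eta * W by nra.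
have -> : 2 * (total q' * W) =
    \sum_j \sum_k 2 * (((q' j)%:R - (q' k)%:R) * U q l z k).
  rewrite WE /total mulr_suml mulr_sumr; apply: eq_bigr => j _.
  rewrite !mulr_sumr; apply: eq_bigr => k _; rewrite mulrBl.
  have -> : (q' k)%:R * U q l z k = 0 by rewrite /q' ffunE; exact: unused_mul.
  by rewrite subr0.
have -> : eta * spread q' + L%:R * B%:R / eta * W =
    \sum_j \sum_k (eta * ((q' j)%:R - (q' k)%:R) ^+ 2 + B%:R / eta * U q l z k).
  transitivity (\sum_j (eta * (\sum_k ((q' j)%:R - (q' k)%:R) ^+ 2) + B%:R / eta * W)).
    rewrite big_split/= -mulr_sumr sum_ord_cst.
    by rewrite /spread; ring.
  by apply: eq_bigr => j _; rewrite big_split/= -!mulr_sumr WE.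
apply: ler_sum => j _; apply: ler_sum => k _.
set y := _ - _; set u := U q l z k.
have u0 : 0 <= u by exact: unused_ge0.
have uB : u * u <= B%:R * u by rewrite ler_wpM2r// U_le.
(* AM-GM: [2 y u <= eta y^2 + u^2 / eta] *)
have : 0 <= (eta * y - u) ^+ 2 / eta by rewrite divr_ge0 ?sqr_ge0// ltW.
have -> : (eta * y - u) ^+ 2 / eta = eta * y ^+ 2 - 2 * (y * u) + u * u / eta.
  by field; rewrite gt_eqF.
have : u * u / eta <= B%:R * u / eta by rewrite ler_wpM2r// invr_ge0 ltW.
lra.
Qed.

Lemma spread_step_le q l z : spread (jsq_step q l z) <= spread q
  + 2 * L%:R * (2 * ((z None)%:R * (q l)%:R)
      - 2 * (\sum_k (q k)%:R * (z (Some k))%:R) + L%:R * B%:R ^+ 2)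
  - 4 * (total q * net_input z).
Proof.
set q' := jsq_step q l z.
have sqr_le : \sum_k (q' k)%:R ^+ 2 <= \sum_k (q k)%:R ^+ 2
    + 2 * ((z None)%:R * (q l)%:R) - 2 * (\sum_k (q k)%:R * (z (Some k))%:R)
    + L%:R * B%:R ^+ 2 :> R.
  have -> : (z None)%:R * (q l)%:R =
      \sum_k (q k)%:R * (if k == l then z None : nat else 0)%N%:R :> R.
    rewrite (bigD1 l)//= eqxx big1 ?addr0 1?mulrC// => k /negbTE ->.
    by rewrite mulr0.
  rewrite -(sum_ord_cst L (B%:R ^+ 2)) !mulr_sumr.
  rewrite -big_split -sumrB -big_split; apply: ler_sum => k _ /=.
  rewrite /q' ffunE; apply: le_trans (positive_part_sqr _ _ _) _.
  set a := (if _ then _ else _).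
  have : (a%:R - (z (Some k))%:R) ^+ 2 <= B%:R ^+ 2 :> R.
    rewrite -real_normK ?num_real// lerXn2r ?nnegrE//.
    have := ler0n R a; have := ler0n R (z (Some k)).
    have : a%:R <= B%:R :> R by rewrite ler_nat arrival_le.
    have : (z (Some k))%:R <= B%:R :> R by rewrite ler_nat leq_ord.
    by rewrite ler_norml; lra.
  nra.
have tot_ge : total q ^+ 2 + 2 * (total q * net_input z) <= total q' ^+ 2.
  have := total_step_ge0 q l z; rewrite -/q'; set W := _ - _ - _ => W0.
  have -> : total q' = total q + (net_input z + W) by rewrite /W; ring.
  have := sqr_ge0 (net_input z + W); have := mulr_ge0 (total_ge0 q) W0.
  nra.
rewrite !spreadE.
have := ler_wpM2l (ler0n R L) sqr_le.
lra.
Qed.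

(** Each length moves by at most [B], hence each difference by at most [2 * B]; Cauchy-Schwarz over
    the [L ^ 2] pairs does the rest. *)
Lemma spread_step_dist q l z : (spread (jsq_step q l z) - spread q) ^+ 2 <=
  L%:R ^+ 2 * (32 * B%:R ^+ 2 * spread q + 32 * B%:R ^+ 4 * L%:R ^+ 2).
Proof.
set q' := jsq_step q l z.
pose y (u : 'I_L * 'I_L) : R := (q u.1)%:R - (q u.2)%:R.
pose y' (u : 'I_L * 'I_L) : R := (q' u.1)%:R - (q' u.2)%:R.
have spreadP r : spread r = \sum_(u : 'I_L * 'I_L) ((r u.1)%:R - (r u.2)%:R) ^+ 2.
  by rewrite /spread pair_big.
rewrite !spreadP -sumrB; apply: le_trans (sqr_sum_le _) _.
rewrite card_prod card_ord natrM -expr2 ler_wpM2l ?sqr_ge0//.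
have -> : 32 * B%:R ^+ 4 * L%:R ^+ 2 =
    \sum_(u : 'I_L * 'I_L) 32 * B%:R ^+ 4 :> R.
  by rewrite sumr_const card_prod card_ord -[RHS]mulr_natr natrM expr2.
rewrite mulr_sumr -big_split; apply: ler_sum => u _ /=.
rewrite -/(y u) -/(y' u).
have dist k : `|(q' k)%:R - (q k)%:R| <= B%:R :> R.
  by rewrite /q' ffunE positive_part_dist ?arrival_le ?leq_ord.
have : `|y' u - y u| <= 2 * B%:R.
  have := dist u.1; have := dist u.2; rewrite !ler_norml /y /y'; lra.
set dl := y' u - y u; move=> dlB.
have dl2 : dl ^+ 2 <= 4 * B%:R ^+ 2.
  rewrite (_ : 4 * _ = (2 * B%:R) ^+ 2); last by ring.
  by rewrite -real_normK ?num_real// lerXn2r ?nnegrE// mulr_ge0.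
have -> : y' u ^+ 2 - y u ^+ 2 = 2 * (y u * dl) + dl ^+ 2 by rewrite /dl; ring.
have dl4 : dl ^+ 2 * dl ^+ 2 <= (4 * B%:R ^+ 2) * (4 * B%:R ^+ 2).
  by apply: ler_pM => //; exact: sqr_ge0.
have ydl : y u ^+ 2 * dl ^+ 2 <= y u ^+ 2 * (4 * B%:R ^+ 2).
  by rewrite ler_wpM2l// sqr_ge0.
(* This square gives [(a + b) ^+ 2 <= 2 * a ^+ 2 + 2 * b ^+ 2] with [a = 2 * (y u * dl)] and
   [b = dl ^+ 2]. *)
have := sqr_ge0 (2 * (y u * dl) - dl ^+ 2).
nra.
Qed.

End spread.

(** * Drift inequalities for the JSQ kernel *)

Section kernel_average.
Context {R : realType} {C : countType} {Z Tg : finType}.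
Context (p : Z -> R) (c : C -> Tg -> R) (step : C -> Tg -> Z -> C).
Hypothesis p0 : forall z, 0 <= p z.
Hypothesis p1 : \sum_z p z = 1.
Hypothesis c0 : forall x l, 0 <= c x l.
Hypothesis c1 : forall x, \sum_l c x l = 1.

(** A one-slot mean whose integrand may depend on the tag and the input, and not only on the next
    state as in [kernel_of]. *)
Definition average (x : C) (h : Tg -> Z -> R) : R :=
  \sum_l c x l * \sum_z p z * h l z.

Lemma kernel_ofE g x : kernel_of p c step g x = average x (fun l z => g (step x l z)).
Proof.
rewrite /kernel_of /average; apply: eq_bigr => l _; rewrite mulr_sumr.
by apply: eq_bigr => z _; rewrite mulrA.
Qed.

Lemma averageD x h h' :
  average x (fun l z => h l z + h' l z) = average x h + average x h'.
Proof.
rewrite /average -big_split; apply: eq_bigr => l _ /=; rewrite -mulrDr -big_split.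
by congr (_ * _); apply: eq_bigr => z _ /=; rewrite mulrDr.
Qed.

Lemma averageZ x a h : average x (fun l z => a * h l z) = a * average x h.
Proof.
rewrite /average mulr_sumr; apply: eq_bigr => l _; rewrite mulrCA; congr (_ * _).
by rewrite mulr_sumr; apply: eq_bigr => z _; rewrite mulrCA.
Qed.

Lemma average_cst x (h : Z -> R) : average x (fun=> h) = \sum_z p z * h z.
Proof. by rewrite /average -mulr_suml c1 mul1r. Qed.

(** The comparison is asked only for tags of nonzero weight, since the drift of [spread] is
    controlled only when the target is a shortest queue. *)
Lemma le_average x h h' :
  (forall l, c x l != 0 -> \sum_z p z * h l z <= \sum_z p z * h' l z) ->
  average x h <= average x h'.
Proof.
move=> hh'; apply: ler_sum => l _; have [->|cl] := eqVneq (c x l) 0.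
  by rewrite !mul0r.
by rewrite ler_wpM2l// hh'.
Qed.

Lemma le_average_pointwise x h h' : (forall l z, h l z <= h' l z) ->
  average x h <= average x h'.
Proof.
by move=> hh'; apply: le_average => l _; apply: ler_sum => z _; rewrite ler_wpM2l.
Qed.

Lemma kernel_of_cst a x : kernel_of p c step (fun=> a) x = a.
Proof.
rewrite kernel_ofE (average_cst x (fun=> a)).
by rewrite -mulr_suml p1 mul1r.
Qed.

Lemma le_kernel_of f g x : (forall y, f y <= g y) ->
  kernel_of p c step f x <= kernel_of p c step g x.
Proof. by move=> fg; rewrite !kernel_ofE; apply: le_average_pointwise => l z. Qed.

End kernel_average.

Section net_input_moments.
Context {R : realType} {L B : nat} (law : option 'I_L -> probability nat R).
Hypothesis bnd : forall k, exists2 M, (M <= B)%N & bounded_law (law k) M.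
Variable eps : R.
Hypothesis epsE :
  eps = \sum_l law_mean (law (Some l)) - law_mean (law None).

(** The second moment of the net input: the variances add up by independence, and the mean is
    [- eps]. *)
Definition second_moment : R :=
  law_var (law None) + \sum_l law_var (law (Some l)) + eps ^+ 2.

Let sign (k : option 'I_L) : R := if k is Some _ then -1 else 1.

Let net_inputE z : @net_input R L B z = \sum_k sign k * (z k)%:R.
Proof.
rewrite big_option_split mul1r /net_input -sumrN; congr (_ + _).
by apply: eq_bigr => l _; rewrite mulN1r.
Qed.

Lemma mean_net_input : input_mean law (@net_input R L B) = - eps.
Proof.
rewrite (eq_input_mean law net_inputE) input_mean_linear// big_option_split.
by rewrite mul1r epsE opprB -sumrN; congr (_ + _); apply: eq_bigr => l _; rewrite mulN1r.
Qed.

Lemma mean_net_input_sqr :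
  input_mean law (fun z => @net_input R L B z ^+ 2) = second_moment.
Proof.
(* Centring turns the net input into itself plus [eps], and the square is rewritten accordingly. *)
have E z : @net_input R L B z ^+ 2 =
    (\sum_k sign k * ((z k)%:R - law_mean (law k))) ^+ 2
    + (- (2 * eps) * net_input z + - (eps ^+ 2)).
  have -> : \sum_k sign k * ((z k)%:R - law_mean (law k)) = net_input z + eps.
    under eq_bigr do rewrite mulrBr.
    rewrite sumrB -net_inputE; congr (_ + _).
    rewrite big_option_split mul1r epsE opprD -sumrN addrC; congr (_ + _).
    by apply: eq_bigr => l _; rewrite mulN1r opprK.
  by ring.
rewrite (eq_input_mean law E) !input_meanD input_meanZ input_mean_cst.
rewrite mean_net_input input_mean_centred_sqr// big_option_split expr1n mul1r.
under eq_bigr do rewrite sqrrN expr1n mul1r.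
by rewrite /second_moment; ring.
Qed.

Lemma mean_shifted_sqr (x : R) :
  input_mean law (fun z => (x + @net_input R L B z) ^+ 2) =
  x ^+ 2 - 2 * eps * x + second_moment.
Proof.
have E z : (x + @net_input R L B z) ^+ 2 =
    x ^+ 2 + (2 * x * net_input z + net_input z ^+ 2) by ring.
rewrite (eq_input_mean law E) !input_meanD input_meanZ input_mean_cst.
by rewrite mean_net_input mean_net_input_sqr; ring.
Qed.

End net_input_moments.

Section jsq_drift.
Context {R : realType} {L B : nat} (law : option 'I_L -> probability nat R).
Hypothesis L0 : (0 < L)%N.
Hypothesis bnd : forall k, exists2 M, (M <= B)%N & bounded_law (law k) M.
Variable eps : R.
Hypothesis epsE :
  eps = \sum_l law_mean (law (Some l)) - law_mean (law None).

Implicit Types (q : {ffun 'I_L -> nat}).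

Definition tie_weight q l : R :=
  if l \in shortest q then (#|shortest q|%:R)^-1 else 0.

Lemma tie_weight_ge0 q l : 0 <= tie_weight q l.
Proof. by rewrite /tie_weight; case: ifP => // _; rewrite invr_ge0. Qed.

Lemma sum_tie_weight q : \sum_l tie_weight q l = 1.
Proof.
rewrite /tie_weight -big_mkcond/= sumr_const -[LHS]mulr_natl divff// pnatr_eq0.
rewrite -lt0n; apply/card_gt0P.
case: (@arg_minnP _ (Ordinal L0) predT (fun l => q l) isT) => l _ ql.
by exists l; rewrite inE; apply/forallP => k; exact: ql.
Qed.

Definition jsq_kernel : ({ffun 'I_L -> nat} -> R) -> {ffun 'I_L -> nat} -> R :=
  kernel_of (@input_weight R _ B law) tie_weight (@jsq_step L B).

Local Notation K := jsq_kernel.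
Local Notation avg := (average (@input_weight R _ B law) tie_weight).

Let w0 := @input_weight_ge0 R (option 'I_L) B law.

Let avg_le := le_average_pointwise (c := tie_weight) w0 tie_weight_ge0.

Let avg_const q h : avg q (fun=> h) = input_mean law h.
Proof. exact: average_cst sum_tie_weight _ _. Qed.

Let avg_unused q : avg q (fun l z => total (jsq_step q l z) - total q - net_input z)
  = K total q - total q + eps.
Proof.
rewrite averageD [K _ _]kernel_ofE averageD.
rewrite (avg_const q (fun=> - total q)) input_mean_cst.
rewrite (avg_const q (fun z => - net_input z)).
congr (_ + _); rewrite -[RHS]opprK -(mean_net_input bnd epsE) -mulN1r -input_meanZ.
by apply: eq_input_mean => z; rewrite mulN1r.
Qed.

Lemma jsq_total_sqr_le q eta : 0 < eta ->
  K (fun q => total q ^+ 2) q <=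
  total q ^+ 2 - 2 * eps * total q + second_moment law eps
    + eta * K spread q + L%:R * B%:R / eta * (K total q - total q + eps).
Proof.
move=> eta0.
rewrite -avg_unused -(mean_shifted_sqr bnd epsE) -(avg_const q).
rewrite [K spread q]kernel_ofE -!averageZ -!averageD.
rewrite [leLHS]kernel_ofE; apply: avg_le => l z.
by have := @total_step_sqr_le R L B q l z _ eta0; lra.
Qed.

Variable mu0 : R.
Hypothesis mu00 : 0 < mu0.
Hypothesis mu0_le : forall l, mu0 <= law_mean (law (Some l)).
Hypothesis eps_le : eps <= L%:R * mu0 / 2.

Let LR0 : 0 < L%:R :> R. Proof. by rewrite ltr0n. Qed.

(* The drift of [spread ^+ 2] is at most
   [spread * (beta - 4 L mu0 * excess) + 32 B^4 L^4], and [spread <= (L * excess)^2];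
   the first summand bounds [spread * (beta + 1 - 4 L mu0 * excess)]. *)
Definition spread_bound : R :=
  let beta := 36 * L%:R ^+ 2 * B%:R ^+ 2 in
  (beta + 1) * L%:R ^+ 2 * ((beta + 1) / (4 * L%:R * mu0)) ^+ 2
    + 32 * B%:R ^+ 4 * L%:R ^+ 4.

Lemma spread_bound_ge0 : 0 <= spread_bound.
Proof.
have muL : 0 <= 4 * L%:R * mu0 by rewrite mulr_ge0 ?ltW// mulr_gt0.
have b0 : 0 <= 36 * L%:R ^+ 2 * B%:R ^+ 2 + 1 :> R.
  by rewrite addr_ge0// !mulr_ge0// ?exprn_ge0.
rewrite /spread_bound addr_ge0//.
by apply: mulr_ge0; [apply: mulr_ge0 => //; exact: exprn_ge0|exact: sqr_ge0].
Qed.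

(** With [total q = L * q l + excess q l] and arrival mean equal to the service means minus [eps],
    all terms in [q l] cancel. What remains is [4 * eps * excess], minus at least
    [4 * L * mu0 * excess], and [eps_le] lets the second absorb the first up to one half. *)
Lemma mean_spread_step q l : l \in shortest q ->
  input_mean law (fun z => spread (@jsq_step L B q l z)) <=
  spread q - 2 * L%:R * mu0 * excess q l + 2 * L%:R ^+ 2 * B%:R ^+ 2.
Proof.
move=> ql.
apply: le_trans (le_input_mean law (@spread_step_le R L B q l)) _.
have E (z : {ffun option 'I_L -> 'I_B.+1}) : spread q
    + 2 * L%:R * (2 * ((z None)%:R * (q l)%:R)
      - 2 * (\sum_k (q k)%:R * (z (Some k))%:R) + L%:R * B%:R ^+ 2)
    - 4 * (total q * net_input z) =
   (spread q + 2 * L%:R ^+ 2 * B%:R ^+ 2) + (- (4 * total q) * net_input z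
    + 4 * L%:R * \sum_k (if k is Some k then - (q k)%:R else (q l)%:R) * (z k)%:R) :> R.
  rewrite big_option_split; under [in RHS]eq_bigr do rewrite mulNr.
  by rewrite sumrN; ring.
rewrite (eq_input_mean law E) input_meanD input_mean_cst input_meanD !input_meanZ.
rewrite (mean_net_input bnd epsE) input_mean_linear// big_option_split.
under eq_bigr do rewrite mulNr.
rewrite sumrN.
have lamE : law_mean (law None) = \sum_l law_mean (law (Some l)) - eps.
  by rewrite epsE; ring.
have exE : total q = L%:R * (q l)%:R + excess q l :> R.
  by rewrite /excess sumrB sum_ord_cst /total; ring.
have -> : \sum_k (q k)%:R * law_mean (law (Some k)) =
   \sum_k ((q k)%:R - (q l)%:R) * law_mean (law (Some k))
   + (q l)%:R * \sum_k law_mean (law (Some k)).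
  by rewrite mulr_sumr -big_split; apply: eq_bigr => k _ /=; ring.
have : mu0 * excess q l <= \sum_k ((q k)%:R - (q l)%:R) * law_mean (law (Some k)).
  rewrite /excess mulr_sumr; apply: ler_sum => k _.
  by rewrite mulrC ler_wpM2l// subr_ge0 shortestP.
set S := \sum_k _ * _ => muS.
rewrite lamE exE.
have ex0 := excess_ge0 (R := R) ql.
have : eps * excess q l <= L%:R * mu0 / 2 * excess q l by rewrite ler_wpM2r.
have : L%:R * (mu0 * excess q l) <= L%:R * S by rewrite ler_wpM2l// ltW.
lra.
Qed.

Lemma jsq_spread_drift q :
  K (fun q => spread q ^+ 2) q <= spread q ^+ 2 - spread q + spread_bound.
Proof.
rewrite -[leRHS](input_mean_cst B law) -(avg_const q) [leLHS]kernel_ofE.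
apply: le_average => [|l]; first exact: tie_weight_ge0.
rewrite /tie_weight; case: ifPn => [ql _|_]; last by rewrite eqxx.
rewrite -/(input_mean law _) -/(input_mean law (fun=> _)) input_mean_cst.
set V : R := spread q.
have V0 : 0 <= V by exact: spread_ge0.
pose G : R := excess q l.
have G0 : 0 <= G by exact: excess_ge0.
have VG : V <= L%:R ^+ 2 * G ^+ 2 by exact: spread_le_excess.
(* The square is expanded around [V]; the increment squared is bounded by [spread_step_dist],
   linearly in [V]. *)
have E (z : {ffun option 'I_L -> 'I_B.+1}) : spread (jsq_step q l z) ^+ 2 <=
    V ^+ 2 + (2 * V * (spread (jsq_step q l z) - V)
    + L%:R ^+ 2 * (32 * B%:R ^+ 2 * V + 32 * B%:R ^+ 4 * L%:R ^+ 2)).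
  have := @spread_step_dist R L B q l z; rewrite -/V; nra.
apply: le_trans (le_input_mean law E) _.
rewrite !input_meanD !input_mean_cst input_meanZ input_meanD input_mean_cst.
have := mean_spread_step ql; rewrite -/V -/G.
set EV := input_mean _ _ => EVle.
pose beta : R := 36 * L%:R ^+ 2 * B%:R ^+ 2.
pose alpha : R := 4 * L%:R * mu0.
have alpha0 : 0 < alpha by rewrite /alpha !mulr_gt0.
have beta0 : 0 <= beta by rewrite /beta !mulr_ge0// sqr_ge0.
have main : V * (beta + 1 - alpha * G) <=
    (beta + 1) * L%:R ^+ 2 * ((beta + 1) / alpha) ^+ 2.
  have rhs0 : 0 <= (beta + 1) * L%:R ^+ 2 * ((beta + 1) / alpha) ^+ 2.
    by apply: mulr_ge0; rewrite ?sqr_ge0// mulr_ge0 ?sqr_ge0// addr_ge0.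
  (* For small excess, [VG] bounds [V] by a constant; for large excess, the bracket is negative. *)
  have [small|big] := leP G ((beta + 1) / alpha).
    apply: (@le_trans _ _ (V * (beta + 1))).
      by rewrite ler_wpM2l//; have := mulr_ge0 (ltW alpha0) G0; lra.
    rewrite mulrC -mulrA ler_wpM2l ?addr_ge0//; apply: le_trans VG _.
    by rewrite ler_wpM2l ?sqr_ge0// lerXn2r ?nnegrE ?divr_ge0 ?addr_ge0// ltW.
  apply: le_trans rhs0; apply: mulr_ge0_le0 => //.
  by move: big; rewrite ltr_pdivrMr// => big; lra.
have : V * (EV + - V) <= V * (- 2 * L%:R * mu0 * G + 2 * L%:R ^+ 2 * B%:R ^+ 2).
  by rewrite ler_wpM2l//; lra.
rewrite /spread_bound -/beta -/alpha.
move: main; rewrite {1}/beta {1}/alpha.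
set X := (beta + 1) * _ * _.
lra.
Qed.

End jsq_drift.

(** * The pooled single-server queue *)

Section single_server.
Context {R : realType} {L B : nat} (law : option 'I_L -> probability nat R).
Hypothesis bnd : forall k, exists2 M, (M <= B)%N & bounded_law (law k) M.
Variable eps : R.
Hypothesis eps0 : 0 < eps.
Hypothesis epsE :
  eps = \sum_l law_mean (law (Some l)) - law_mean (law None).

(** The tag of type [unit] makes this queue an instance of the general chain, with no routing
    choice. *)
Definition single_step (x : nat) (u : unit) (z : {ffun option 'I_L -> 'I_B.+1}) : nat :=
  (x + z None - \sum_l z (Some l))%N.

Definition single_kernel : (nat -> R) -> nat -> R :=
  kernel_of (@input_weight R _ B law) (fun _ _ => 1) single_step.

Local Notation K := single_kernel.
Local Notation v := (second_moment law eps).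

Let KE f x : K f x = input_mean law (fun z => f (single_step x tt z)).
Proof.
by rewrite [LHS]kernel_ofE /average (eq_bigl (pred1 tt)) ?big_pred1_eq ?mul1r// => -[].
Qed.

(** The mean of [f] at time [t] for the queue started empty, as an iterate of the kernel; every such
    mean is a finite sum. *)
Definition single_expect (t : nat) (f : nat -> R) : R := iter t K f 0%N.

Local Notation J := single_expect.

Lemma single_expectS t f : J t.+1 f = J t (K f).
Proof. by rewrite /J iterSr. Qed.

Lemma single_expectD t f g : J t (fun x => f x + g x) = J t f + J t g.
Proof.
elim: t f g => [//|t IH] f g; rewrite !single_expectS -IH; congr (J t _).
by apply/funext => x; rewrite !KE input_meanD.
Qed.

Lemma single_expectZ t a f : J t (fun x => a * f x) = a * J t f.
Proof.
elim: t f => [//|t IH] f; rewrite !single_expectS -IH; congr (J t _).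
by apply/funext => x; rewrite !KE input_meanZ.
Qed.

Lemma single_expect_cst t a : J t (fun=> a) = a.
Proof.
elim: t => [//|t IH]; rewrite single_expectS -[RHS]IH; congr (J t _).
by apply/funext => x; rewrite KE input_mean_cst.
Qed.

Lemma le_single_expect t f g : (forall x, f x <= g x) -> J t f <= J t g.
Proof.
elim: t f g => [|t IH] f g fg; first exact: fg.
by rewrite !single_expectS; apply: IH => x; rewrite !KE; apply: le_input_mean.
Qed.

(** The kernel preserves monotonicity, and the first step leads from the least state 0 to a state at
    least as large; conditioning on that step gives the claim. *)
Lemma single_expect_nondecreasing t f : {homo f : x y / (x <= y)%N >-> x <= y} ->
  J t f <= J t.+1 f.
Proof.
move=> ndf.
have {ndf} : {homo iter t K f : x y / (x <= y)%N >-> x <= y}.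
  elim: t => [//|t IH] x y xy /=; rewrite !KE; apply: le_input_mean => z.
  by apply: IH; rewrite /single_step leq_sub2r// leq_add2r.
move=> ndf; rewrite /J [leRHS]/= KE -[leLHS](input_mean_cst B law).
by apply: le_input_mean => z; exact: ndf.
Qed.

Let M : R := L%:R * B%:R.

Let M0 : 0 <= M. Proof. exact: mulr_ge0. Qed.

Let serv (z : {ffun option 'I_L -> 'I_B.+1}) : nat := (\sum_l z (Some l))%N.

Let serv_le z : (serv z)%:R <= M.
Proof.
rewrite /serv natr_sum /M -sum_ord_cst; apply: ler_sum => l _.
by rewrite ler_nat leq_ord.
Qed.

Let netE z : net_input z = (z None)%:R - (serv z)%:R :> R.
Proof. by rewrite /net_input /serv natr_sum. Qed.

Implicit Types (z : {ffun option 'I_L -> 'I_B.+1}).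

Let used x z : R := unused x (z None) (serv z).

Let stepE x z : (single_step x tt z)%:R = x%:R + net_input z + used x z.
Proof. by rewrite /used /unused netE -/(serv z) /single_step -/(serv z); ring. Qed.

Lemma single_sqr_ge x :
  x%:R ^+ 2 - 2 * eps * x%:R + v - M * (K (fun x => x%:R) x - x%:R + eps)
  <= K (fun x => x%:R ^+ 2) x.
Proof.
have -> : K (fun x => x%:R) x - x%:R + eps = input_mean law (used x).
  rewrite KE (eq_input_mean law (stepE x)) input_meanD input_meanD input_mean_cst.
  by rewrite (mean_net_input bnd epsE); ring.
rewrite KE -(mean_shifted_sqr bnd epsE) -mulNr -input_meanZ -input_meanD.
apply: le_input_mean => z.
have u0 : 0 <= used x z by exact: unused_ge0.
have uM : used x z <= M by apply: le_trans (unused_le _ _ _) (serv_le z).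
have := mulr_ge0 u0 (etrans (subr_ge0 _ _) uM).
have : (single_step x tt z)%:R * used x z = 0 by exact: unused_mul.
by rewrite stepE; nra.
Qed.

Lemma single_sqr_le x :
  K (fun x => x%:R ^+ 2) x <= x%:R ^+ 2 - 2 * eps * x%:R + v.
Proof.
rewrite KE -(mean_shifted_sqr bnd epsE); apply: le_input_mean => z.
by rewrite netE addrA; exact: positive_part_sqr.
Qed.

Lemma single_cube_le x : K (fun x => x%:R ^+ 3) x <=
  x%:R ^+ 3 - 3 * eps * x%:R ^+ 2 + 3 * v * x%:R + (B%:R ^+ 3 + M ^+ 3).
Proof.
rewrite KE.
have step_le z : (single_step x tt z)%:R ^+ 3 <=
    (x%:R ^+ 3 + (B%:R ^+ 3 + M ^+ 3)) +
    (3 * x%:R ^+ 2 * net_input z + 3 * x%:R * net_input z ^+ 2).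
  have D3 : net_input z ^+ 3 <= B%:R ^+ 3 :> R.
    have [D0|D0] := leP 0 (net_input z : R).
      have zB : (z None)%:R <= B%:R :> R by rewrite ler_nat leq_ord.
      rewrite lerXn2r ?nnegrE// netE; have := ler0n R (serv z); lra.
    apply: (@le_trans _ _ 0); last by rewrite exprn_ge0.
    by rewrite exprS; apply: mulr_le0_ge0; rewrite ?sqr_ge0// ltW.
  apply: (@le_trans _ _ ((x%:R + net_input z) ^+ 3 + M ^+ 3)); last by nra.
  have M3 : 0 <= M ^+ 3 by exact: exprn_ge0.
  have := unused_cases (R := R) x (z None) (serv z); rewrite -/(used x z).
  case=> [[_ u0]|[xz [uE _]]]; first by rewrite stepE u0 addr0 lerDl.
  have -> : (single_step x tt z)%:R = 0 :> R by exact: xz.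
  have -> : x%:R + net_input z = - used x z by rewrite uE netE; ring.
  rewrite expr0n/= exprNn [(-1) ^+ 3](_ : _ = -1); last by ring.
  rewrite mulN1r addrC subr_ge0 lerXn2r ?nnegrE//; first exact: unused_ge0.
  by apply: le_trans (unused_le _ _ _) (serv_le z).
apply: le_trans (le_input_mean law step_le) _.
rewrite input_meanD input_mean_cst input_meanD !input_meanZ.
by rewrite (mean_net_input bnd epsE) (mean_net_input_sqr bnd epsE); lra.
Qed.

Let v0 : 0 <= v.
Proof.
rewrite -(mean_net_input_sqr bnd epsE); apply: sumr_ge0 => z _.
by rewrite mulr_ge0 ?sqr_ge0// input_weight_ge0.
Qed.

Let homo_pow n : {homo (fun x : nat => x%:R ^+ n : R) : x y / (x <= y)%N >-> x <= y}.
Proof. by move=> x y xy; rewrite lerXn2r ?nnegrE// ler_nat. Qed.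

(** The second moment does not decrease in time, yet its drift is at most [v - 2 * eps] times the
    mean. The next bound uses the cube in the same way. *)
Let J1_le t : J t (fun x => x%:R) <= v / (2 * eps).
Proof.
have := le_trans (single_expect_nondecreasing t (@homo_pow 2)).
rewrite single_expectS => /(_ _ (le_single_expect t single_sqr_le)).
rewrite 2!single_expectD single_expect_cst.
rewrite (_ : J t (fun x => - (2 * eps * x%:R)) =
  - (2 * eps) * J t (fun x => x%:R)); last first.
  by rewrite -single_expectZ; congr (J t _); apply/funext => x; ring.
by rewrite ler_pdivlMr ?mulr_gt0//; lra.
Qed.

Definition second_moment_bound : R :=
  (3 * v * (v / (2 * eps)) + (B%:R ^+ 3 + M ^+ 3)) / (3 * eps).

Let J2_le t : J t (fun x => x%:R ^+ 2) <= second_moment_bound.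
Proof.
have := le_trans (single_expect_nondecreasing t (@homo_pow 3)).
rewrite single_expectS => /(_ _ (le_single_expect t single_cube_le)).
rewrite 3!single_expectD single_expect_cst.
rewrite (_ : J t (fun x => - (3 * eps * x%:R ^+ 2)) =
  - (3 * eps) * J t (fun x => x%:R ^+ 2)); last first.
  by rewrite -single_expectZ; congr (J t _); apply/funext => x; ring.
rewrite single_expectZ /second_moment_bound ler_pdivlMr ?mulr_gt0//.
by have := ler_wpM2l v0 (J1_le t); lra.
Qed.

Lemma second_moment_bound_ge0 : 0 <= second_moment_bound.
Proof. by apply: le_trans (J2_le 0); rewrite /J/= sqr_ge0. Qed.

(** The lower drift bound is summed over the slots before [T]. As the mean is nondecreasing in time,
    the sum of the means is at most [T] times the last one. *)
Let telescoping T : T%:R * (v - M * eps) <=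
  2 * eps * (T%:R * J T (fun x => x%:R)) + M * J T (fun x => x%:R)
  + J T (fun x => x%:R ^+ 2).
Proof.
elim: T => [|T IH].
  by rewrite /J/= expr0n !mul0r !mulr0 !addr0.
have := le_single_expect T single_sqr_ge; rewrite -!single_expectS.
rewrite 3!single_expectD single_expect_cst.
rewrite (_ : J T (fun x => - (2 * eps * x%:R)) =
  - (2 * eps) * J T (fun x => x%:R)); last first.
  by rewrite -single_expectZ; congr (J T _); apply/funext => x; ring.
rewrite (_ : J T (fun x => - (M * (K (fun x => x%:R) x - x%:R + eps))) =
  - M * (J T.+1 (fun x => x%:R) + - J T (fun x => x%:R) + eps)); last first.
  rewrite single_expectS -[- J T _]mulN1r -(single_expectZ T (-1)).
  rewrite -[X in _ + X](single_expect_cst T eps) -single_expectD -single_expectD.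
  rewrite -single_expectZ; congr (J T _).
  by apply/funext => x; ring.
have nd := single_expect_nondecreasing T (@homo_pow 1).
have : 0 <= eps * (T.+1%:R * (J T.+1 (fun x => x%:R) - J T (fun x => x%:R))).
  by rewrite !mulr_ge0 ?(ltW eps0)// subr_ge0.
rewrite -natr1; lra.
Qed.

(** Convergence in distribution tests bounded functions only, so the length is truncated at [N]; the
    second moment bound controls the loss uniformly in time. *)
Lemma single_truncated_ge (T : nat) (N : R) : (0 < T)%N -> 0 < N ->
  v - M * eps - (M * (v / (2 * eps)) + second_moment_bound) / T%:R
    - 2 * eps * (second_moment_bound / N)
  <= 2 * eps * J T (fun x => Num.min x%:R N).
Proof.
move=> T0 N0; have TR0 : 0 < T%:R :> R by rewrite ltr0n.
have trunc : J T (fun x => x%:R) - second_moment_bound / N <=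
    J T (fun x => Num.min x%:R N).
  (* The parabola [x - x ^ 2 / N] lies below both [x] and [N]. *)
  apply: (@le_trans _ _ (J T (fun x => x%:R + - N^-1 * x%:R ^+ 2))).
    rewrite single_expectD single_expectZ mulNr lerD2l lerN2 mulrC.
    by rewrite ler_wpM2r// invr_ge0 ltW.
  apply: le_single_expect => x; rewrite le_min; apply/andP; split.
    by rewrite mulNr gerDl oppr_le0 mulr_ge0 ?sqr_ge0// invr_ge0 ltW.
  have [xN|Nx] := leP x%:R N.
    apply: le_trans xN; rewrite mulNr gerDl oppr_le0.
    by rewrite mulr_ge0 ?sqr_ge0// invr_ge0 ltW.
  apply: (@le_trans _ _ 0); last exact: ltW.
  rewrite (_ : x%:R + _ = x%:R * (N - x%:R) / N); last by field; rewrite gt_eqF.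
  apply: mulr_le0_ge0; last by rewrite invr_ge0 ltW.
  by apply: mulr_ge0_le0 => //; rewrite subr_le0 ltW.
have := ler_wpM2l (ltW eps0) trunc.
have : (v - M * eps) - (M * (v / (2 * eps)) + second_moment_bound) / T%:R
    <= 2 * eps * J T (fun x => x%:R).
  rewrite lerBlDr -(ler_pM2l TR0).
  have := telescoping T; have := ler_wpM2l M0 (J1_le T); have := J2_le T.
  set c := M * (v / _) + _.
  have -> : T%:R * (2 * eps * J T (fun x => x%:R) + c / T%:R) =
     2 * eps * (T%:R * J T (fun x => x%:R)) + c by field; rewrite gt_eqF.
  rewrite /c; lra.
lra.
Qed.

End single_server.

(** * The lower bound for every feasible policy *)

Lemma rv_expect_ffun (R : realType) (L : nat) (Y : random_vector R L)
    (g : {ffun 'I_L -> nat} -> R) :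
  rv_expect Y (fun q => g (finfun q)) =
  (\int[rv_prob Y]_w (g [ffun l => rv_coord Y l w])%:E)%E.
Proof. by rewrite /rv_expect expectation.unlock. Qed.

Lemma discernible_coord (R : realType) (L : nat) (Y : random_vector R L) :
  discernible measurable (fun w => [ffun l => rv_coord Y l w]).
Proof.
by apply: (discernible_ffun (sigma_algebra_measurable _)) => l; exact: discernible_RV.
Qed.

Section lower_bound.
Context {R : realType} {L : nat} (m : routing_model R L).
Context (arr : probability nat R) (svc : 'I_L -> probability nat R).
Context (Amax Smax : nat).
Hypothesis Hprim : has_primitives m arr svc.
Hypothesis Harr : bounded_law arr Amax.
Hypothesis Hsvc : forall l, bounded_law (svc l) Smax.

Local Notation P := (rm_prob m).
Local Notation law := (input_law arr svc).
Let B := maxn Amax Smax.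
Let sM := sigma_algebra_measurable (rm_space m).

Fixpoint pooled (t : nat) (w : rm_space m) : nat :=
  if t is t'.+1
  then (pooled t' w + arrivals m t' w - \sum_l services m t' l w)%N else 0.

(** A sum of positive parts dominates the positive part of the sum, whatever the routing, and the
    pooled queue starts at 0. *)
Lemma pooled_le t w : (pooled t w <= \sum_l queue m t l w)%N.
Proof.
elim: t => [//|t IH] /=; rewrite leq_subLR -(routed_sum (r := m) t w).
apply: (@leq_trans (\sum_l (queue m t l w + routed m t l w))%N).
  by rewrite big_split/= leq_add2r.
rewrite -big_split/=; apply: leq_sum => l _.
by rewrite queue_step addnC -leq_subLR leqnn.
Qed.

Lemma discernible_pooled t : discernible measurable (pooled t).
Proof.
elim: t => [|t IH]; first exact: (discernible_cst sM 0%N).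
have dS : discernible measurable (fun w => [ffun l => services m t l w]).
  by apply: (discernible_ffun sM) => l; exact: discernible_RV.
have := discernible_pair sM (discernible_pair sM IH (discernible_RV (arrivals m t))) dS.
move=> /(discernible_comp sM (fun u : nat * nat * {ffun 'I_L -> nat} =>
  (u.1.1 + u.1.2 - \sum_l u.2 l)%N)) h n.
have := h n; congr measurable; apply/funext => w /=; congr (_ = n).
by congr (_ - _)%N; apply: eq_bigr => l _; rewrite ffunE.
Qed.

Lemma discernible_model_input t : discernible measurable (model_input B (m := m) t).
Proof. by apply: (discernible_clamped sM) => k; exact: discernible_RV. Qed.

Lemma pooled_expect t (g : nat -> R) : (forall x, 0 <= g x) ->
  (\int[P]_w (g (pooled t w))%:E = (single_expect (B := B) law t g)%:E)%E.
Proof.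
elim: t g => [|t IH] g g0.
  by rewrite /= (integral_cst P measurableT) [X in (_ * X)%E](probability_setT P) mule1.
rewrite (@chain_expect _ _ _ P _ _ unit pooled (model_input B (m := m))
  (fun _ _ => tt) (@input_weight R _ B law) (fun _ _ => 1)
  (@single_step L B)) //.
- rewrite (IH (single_kernel law g)) ?single_expectS// => x.
  by apply: kernel_of_ge0 => // z; exact: input_weight_ge0.
- exact: input_weight_ge0.
- exact: discernible_pooled.
- exact: discernible_model_input.
- by move=> s; exact: discernible_cst.
- move=> s x [] ys; rewrite mul1e (_ : [set w | tt = tt] = setT) ?setIT//.
  by apply/seteqP; split.
- move=> x ys; have [x0|/eqP x0] := eqVneq 0%N x.
    rewrite (_ : [set w | pooled 0 w = x] = setT); last by apply/seteqP; split.
    rewrite setTI [X in (X * _)%E](probability_setT P) mul1e.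
    exact: prob_model_cylinder Hprim _.
  rewrite (_ : [set w | pooled 0 w = x] = set0); last by apply/seteqP; split.
  by rewrite set0I measure0 mul0e.
- move=> s; apply: filterS (primitive_small Hprim Harr Hsvc s) => w small /=.
  rewrite /single_step /model_input /clamped; congr (_ + _ - _)%N.
    by rewrite ffunE clamp_small//; exact: (small None).
  by apply: eq_bigr => l _; rewrite ffunE clamp_small//; exact: (small (Some l)).
Qed.

Variable eps : R.
Hypothesis eps0 : 0 < eps.
Hypothesis epsE : eps = total_mean svc - law_mean arr.
Variable Y : random_vector R L.
Hypothesis HY : steady_state m Y.

Lemma mean_total_ge0 : (0 <= mean_total Y)%E.
Proof.
rewrite /mean_total /rv_expect expectation.unlock; apply: integral_ge0 => w _.
by rewrite lee_fin.
Qed.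

(** At a fixed truncation level [N], time goes to infinity by convergence in distribution;
    afterwards [N] is taken large. *)
Lemma steady_mean_total_ge :
  ((second_moment law eps - L%:R * B%:R * eps)%:E
   <= (2 * eps)%:E * mean_total Y)%E.
Proof.
have bnd := input_law_bounded Harr Hsvc.
have b0 := second_moment_bound_ge0 bnd eps0 epsE.
set b := second_moment_bound _ _ in b0.
set v := second_moment law eps.
set M := L%:R * B%:R.
pose C := M * (v / (2 * eps)) + b.
suff trunc N : 0 < N ->
    ((v - M * eps - 2 * eps * (b / N))%:E <= (2 * eps)%:E * mean_total Y)%E.
  have := mean_total_ge0; case EY : (mean_total Y) => [r| |]//; last first.
    by move=> _; rewrite gt0_muley ?lte_fin ?mulr_gt0// leey.
  move=> _; rewrite -EFinM lee_fin; apply/ler_addgt0Pr => dl dl0.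
  (* Large enough for the truncation loss [2 * eps * (b / N)] to be at most [dl]; the summand 1
     keeps [N] positive. *)
  pose N := 2 * eps * b / dl + 1.
  have N0 : 0 < N.
    rewrite ltr_wpDl// divr_ge0// ?(ltW dl0)//.
    by apply: mulr_ge0 => //; apply: mulr_ge0 => //; exact: ltW.
  have := trunc _ N0; rewrite EY -EFinM lee_fin.
  suff : 2 * eps * (b / N) <= dl by lra.
  rewrite mulrA ler_pdivrMr// (_ : dl * N = 2 * eps * b + dl).
    by rewrite lerDl ltW.
  by rewrite /N; field; rewrite gt_eqF.
move=> N0.
pose f (q : 'I_L -> nat) : R := Num.min (\sum_l q l)%N%:R N.
have f_le q : `|f q| <= N.
  rewrite ger0_norm; first by rewrite /f ge_min lexx orbT.
  by rewrite /f le_min ler0n ltW.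
have cvgf := HY f_le.
have lim_ge :
  (((v - M * eps - 2 * eps * (b / N)) / (2 * eps))%:E <= rv_expect Y f)%E.
  apply/lee_addgt0Pr => dl dl0.
  rewrite -leeBlDr//; apply: (cvge_ge _ cvgf).
  (* From this time on, the boundary term [C / t] is at most [2 * eps * dl]. *)
  exists (Num.truncn (C / (2 * eps * dl))).+1 => // t /= tC.
  have t0 : (0 < t)%N by exact: leq_trans tC.
  have := single_truncated_ge bnd eps0 epsE t0 N0.
  set Jt := single_expect _ _ _ => Jge.
  apply: (@le_trans _ _ Jt%:E).
    rewrite -EFinB lee_fin lerBlDr ler_pdivrMr ?mulr_gt0//.
    suff : C / t%:R <= 2 * eps * dl by move: Jge; rewrite -/b -/v -/M -/C; lra.
    rewrite ler_pdivrMr ?ltr0n// -ler_pdivrMl ?mulr_gt0// mulrC.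
    apply: le_trans (ltW (truncnS_gt _)) _; by rewrite ler_nat.
  rewrite -(@pooled_expect t (fun x => Num.min x%:R N)); last first.
    by move=> x; rewrite le_min ler0n ltW.
  rewrite /rv_expect expectation.unlock; apply: ge0_le_integral => //.
  - by move=> w _; rewrite lee_fin le_min ler0n ltW.
  - exact: (measurable_fun_discernible (discernible_pooled t)
      (fun x => (Num.min x%:R N)%:E)).
  - have := @measurable_fun_discernible _ _ R _ _ (discernible_coord (queue_vector m t))
      (fun q => (f q)%:E) setT.
    congr measurable_fun; apply/funext => w; congr (EFin (f _)).
    by apply/funext => l; rewrite ffunE.
  - move=> w _; rewrite lee_fin le_min ge_min ler_nat pooled_le/=.
    by rewrite ge_min lexx orbT.
apply: (@le_trans _ _ ((2 * eps)%:E * rv_expect Y f)%E).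
  rewrite -lee_pdivrMl ?mulr_gt0// -EFinM.
  by rewrite [X in X%:E](_ : _ = (v - M * eps - 2 * eps * (b / N)) / (2 * eps))// mulrC.
apply: lee_wpmul2l; first by rewrite lee_fin mulr_ge0// ltW.
rewrite /mean_total /rv_expect expectation.unlock; apply: ge0_le_integral => //.
- by move=> w _; rewrite lee_fin le_min ler0n ltW.
- have := @measurable_fun_discernible _ _ R _ _ (discernible_coord Y)
    (fun q => (f q)%:E) setT.
  congr measurable_fun; apply/funext => w; congr (EFin (f _)).
  by apply/funext => l; rewrite ffunE.
- have := @measurable_fun_discernible _ _ R _ _ (discernible_coord Y)
    (fun q => (\sum_l q l)%N%:R%:E) setT.
  congr measurable_fun; apply/funext => w; congr (EFin (_%:R)).
  by apply: eq_bigr => l _; rewrite ffunE.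
- by move=> w _; rewrite lee_fin ge_min lexx.
Qed.

End lower_bound.

(** * The steady state under JSQ *)

Section jsq_chain.
Context {R : realType} {L : nat} (m : routing_model R L).
Context (arr : probability nat R) (svc : 'I_L -> probability nat R).
Context (Amax Smax : nat).
Hypothesis Hprim : has_primitives m arr svc.
Hypothesis Harr : bounded_law arr Amax.
Hypothesis Hsvc : forall l, bounded_law (svc l) Smax.
Hypothesis Hjsq : is_jsq m.

Local Notation P := (rm_prob m).
Local Notation law := (input_law arr svc).
Let B := maxn Amax Smax.
Let sM := sigma_algebra_measurable (rm_space m).

Let X (t : nat) (w : rm_space m) : {ffun 'I_L -> nat} := [ffun l => queue m t l w].

(** By induction along the queue recursion, the lengths up to slot [t] are functions of the initial
    lengths, the inputs and the earlier targets. *)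
Let discernible_history (target : nat -> rm_space m -> 'I_L) t (s : nat) :
  (forall t l w, routed m t l w = (if l == target t w then arrivals m t w else 0)%N) ->
  (s <= t)%N -> discernible (tie_history target t) (X s).
Proof.
move=> routedE; have sG := sigma_algebra_gen (init_generators (m := m)
  `|` primitive_generators (m := m)
  `|` generators (fun (s : 'I_t) w => nat_of_ord (target s w))).
elim: s => [_|s IH st].
  apply: (discernible_ffun sG) => l.
  by apply: (@discernible_gen _ _ _ (fun l => queue m 0%N l) _ l) => A gA; left; left.
have dprim k : discernible (tie_history target t) (primitive m k s).
  apply: (@discernible_gen _ _ _ (fun kt => primitive m kt.1 kt.2) _ (k, s)).
  by move=> A gA; left; right.
have dtgt : discernible (tie_history target t) (fun w => target s w).
  have dn : discernible (tie_history target t) (fun w => nat_of_ord (target s w)).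
    by apply: (@discernible_gen _ _ _ (fun (s : 'I_t) w => nat_of_ord (target s w)) _
      (Ordinal st)) => A gA; right.
  move=> l; have := dn l; congr (tie_history _ _); apply/seteqP.
  by split => w /= => [/val_inj|->].
have dall : discernible (tie_history target t) (fun w => [ffun k => primitive m k s w]).
  exact: (discernible_ffun sG).
have := discernible_pair sG (discernible_pair sG (IH (ltnW st)) dtgt) dall.
move=> /(discernible_comp sG
  (fun u : {ffun 'I_L -> nat} * 'I_L * {ffun option 'I_L -> nat} =>
    [ffun l => (u.1.1 l + (if l == u.1.2 then u.2 None else 0) - u.2 (Some l))%N])) h q.
have := h q; congr (tie_history _ _); apply/funext => w /=; congr (_ = q).
by apply/ffunP => l; rewrite !ffunE /= queue_step routedE.
Qed.

(** The target is the tag of the chain. As [tie_history] contains the whole input processes,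
    [uniform_ties] applies to the present state together with a cylinder of present and future
    inputs. *)
Lemma jsq_expect t (g : {ffun 'I_L -> nat} -> R) : (forall q, 0 <= g q) ->
  (\int[P]_w (g (X t.+1 w))%:E = \int[P]_w (jsq_kernel (B := B) law g (X t w))%:E)%E.
Proof.
move=> g0; have [indep0 [target [mtarget _ routedE ties]]] := Hjsq.
have measX s : discernible measurable (X s).
  by apply: (discernible_ffun sM) => l; exact: discernible_RV.
have sI := sigma_algebra_gen (init_generators (m := m)).
have sP := sigma_algebra_gen (primitive_generators (m := m)).
rewrite (@chain_expect _ _ _ P _ _ _ X (model_input B (m := m)) target
  (@input_weight R _ B law) (@tie_weight R L) (@jsq_step L B)) //.
- exact: input_weight_ge0.
- exact: tie_weight_ge0.
- exact: discernible_model_input.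
- move=> s x l ys.
  have := ties s l (shortest x)
    ([set w | X s w = x] `&` cylinder (model_input B (m := m)) ys s).
  (* Fixing the state already fixes the set of shortest queues. *)
  have GD : [set w | X s w = x] `&` cylinder (model_input B (m := m)) ys s
      `&` [set w | shortest (fun i => queue m s i w) = shortest x] =
      [set w | X s w = x] `&` cylinder (model_input B (m := m)) ys s.
    apply: setIidl => w [/= <- _]; apply/setP => i; rewrite !inE.
    by apply: eq_forallb => j; rewrite !ffunE.
  rewrite /= GD; apply.
  have sG := sigma_algebra_gen (init_generators (m := m)
    `|` primitive_generators (m := m)
    `|` generators (fun (s' : 'I_s) w => nat_of_ord (target s' w))).
  apply: (sigma_algebra_setI sG); first exact: (discernible_history routedE (leqnn s)).
  apply: (sigma_algebra_cylinder ys s sG) => r; apply: (discernible_clamped sG) => k.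
  apply: (@discernible_gen _ _ _ (fun kt => primitive m kt.1 kt.2) _ (k, r)).
  by move=> A gA; left; right.
- move=> x ys.
  rewrite -(prob_model_cylinder (Amax := Amax) (Smax := Smax) Hprim).
  pose F (b : bool) := if b then [set w | X 0%N w = x]
    else cylinder (model_input B (m := m)) ys 0.
  have := indep0 [:: true; false] F; rewrite bigcap_seq !big_cons !big_nil setIT mule1.
  apply => //; case=> _ /=.
    apply: (discernible_ffun sI) => l.
    exact: (@discernible_gen _ _ _ (fun l => queue m 0%N l) _ l).
  apply: (sigma_algebra_cylinder ys 0 sP) => r; apply: (discernible_clamped sP) => k.
  exact: (@discernible_gen _ _ _ (fun kt => primitive m kt.1 kt.2) _ (k, r)).
- move=> s; apply: filterS (primitive_small Hprim Harr Hsvc s) => w small.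
  apply/ffunP => l; rewrite !ffunE queue_step routedE.
  by rewrite (clamp_small (small None)) (clamp_small (small (Some l))).
Qed.

Context (Y : random_vector R L).
Hypothesis HY : steady_state m Y.
Hypothesis L0 : (0 < L)%N.

Definition steady_expect (g : {ffun 'I_L -> nat} -> R) : \bar R :=
  (\int[rv_prob Y]_w (g [ffun l => rv_coord Y l w])%:E)%E.

Local Notation K := (jsq_kernel (B := B) law).

Let measurable_steady (g : {ffun 'I_L -> nat} -> R) :
  measurable_fun setT (fun w => (g [ffun l => rv_coord Y l w])%:E).
Proof.
exact: (measurable_fun_discernible (discernible_coord Y) (fun q => (g q)%:E)).
Qed.

Let K_ge0 g q : (forall q, 0 <= g q) -> 0 <= K g q.
Proof.
move=> g0; apply: kernel_of_ge0 => // [z|q' l].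
  exact: input_weight_ge0.
exact: tie_weight_ge0.
Qed.

Let le_K g h q : (forall q, g q <= h q) -> K g q <= K h q.
Proof.
move=> gh; apply: le_kernel_of => //; first exact: input_weight_ge0.
exact: tie_weight_ge0.
Qed.

(** The means of [K g] at time [t] and of [g] at time [t + 1] agree; both sequences converge in
    distribution, as [K g] has the same bounds as [g], and limits are unique. *)
Let stationary_bounded (g : {ffun 'I_L -> nat} -> R) (M : R) :
  (forall q, 0 <= g q <= M) -> steady_expect (K g) = steady_expect g.
Proof.
move=> gM.
have g0 q : 0 <= g q by case/andP: (gM q).
have cvgE h : (forall q, 0 <= h q <= M) ->
    (\int[P]_w (h (X t w))%:E)%E @[t --> \oo] --> steady_expect h.
  move=> hM; have hb (q : 'I_L -> nat) : `|h (finfun q)| <= M.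
    by have /andP[h0 hq] := hM (finfun q); rewrite ger0_norm.
  have := HY hb; rewrite rv_expect_ffun; apply: cvg_trans.
  by apply: near_eq_cvg; near=> t; rewrite rv_expect_ffun.
have KM q : 0 <= K g q <= M.
  apply/andP; split; first exact: K_ge0.
  apply: le_trans (le_K q (h := fun=> M) _) _; first by move=> r; case/andP: (gM r).
  rewrite /jsq_kernel kernel_of_cst//; first exact: sum_input_weight.
  exact: sum_tie_weight.
have cvgK : (\int[P]_w (K g (X t w))%:E)%E @[t --> \oo] --> steady_expect g.
  have := cvgE _ gM; rewrite -cvg_shiftS; apply: cvg_trans; apply: near_eq_cvg.
  by near=> t; rewrite /= jsq_expect.
exact: (cvg_unique (@ereal_hausdorff R) (cvgE _ KM) cvgK).
Unshelve. all: by end_near.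
Qed.

(* Truncations of [g] are bounded test functions; monotone convergence then
   removes the bound without any moment condition. *)
Lemma stationary (g : {ffun 'I_L -> nat} -> R) : (forall q, 0 <= g q) ->
  steady_expect (K g) = steady_expect g.
Proof.
move=> g0; pose gn n q := Num.min (g q) n%:R.
have gn0 n q : 0 <= gn n q by rewrite le_min g0 ler0n.
have gnS q : {homo gn^~ q : n k / (n <= k)%N >-> n <= k}.
  by move=> n k nk; rewrite /gn le_min !ge_min lexx/= ler_nat nk orbT.
have gn_eq q n : g q <= n%:R -> gn n q = g q by move=> h; apply/min_idPl.
have mono (h : nat -> {ffun 'I_L -> nat} -> R) k : (forall n q, 0 <= h n q) ->
    (forall q, {homo h^~ q : n k / (n <= k)%N >-> n <= k}) ->
    (forall q, \forall n \near \oo, h n q = k q) ->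
    steady_expect (h n) @[n --> \oo] --> steady_expect k.
  move=> h0 nd ev.
  have -> : steady_expect k = (\int[rv_prob Y]_w
      (limn (fun n => (h n [ffun l => rv_coord Y l w])%:E)))%E.
    apply: eq_integral => w _; apply/esym/lim_near_cst => //.
    by apply: filterS (ev [ffun l => rv_coord Y l w]) => n ->.
  apply: cvg_monotone_convergence => //.
  - by move=> n w _; rewrite lee_fin.
  - by move=> w _ n n' nn'; rewrite lee_fin nd.
have eventually_le (x : R) : \forall n \near \oo, x <= n%:R.
  exists (Num.truncn x).+1 => // n /= xn; apply: le_trans (ltW (truncnS_gt _)) _.
  by rewrite ler_nat.
have cvg_g : steady_expect (gn n) @[n --> \oo] --> steady_expect g.
  apply: mono => // q; apply: filterS (eventually_le (g q)) => n; exact: gn_eq.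
have cvg_K : steady_expect (K (gn n)) @[n --> \oo] --> steady_expect (K g).
  apply: mono => [n q|q n n' nn'|q].
  - exact: K_ge0.
  - by apply: le_K => r; exact: gnS.
  - apply: filterS (eventually_le (\sum_l \sum_z g (@jsq_step L B q l z))) => n hn.
    apply: eq_bigr => l _; apply: eq_bigr => z _; congr (_ * _); apply: gn_eq.
    apply: le_trans hn; rewrite (bigD1 l)//= (bigD1 z)//= -addrA lerDl.
    apply: addr_ge0; first exact: sumr_ge0.
    by apply: sumr_ge0 => j _; exact: sumr_ge0.
apply: (cvg_unique (@ereal_hausdorff R) cvg_K); move: cvg_g; apply: cvg_trans.
apply: near_eq_cvg; near=> n.
by rewrite (@stationary_bounded (gn n) n%:R)// => q; rewrite gn0/= ge_min lexx orbT.
Unshelve. all: by end_near.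
Qed.

Lemma steady_expectD g h : (forall q, 0 <= g q) -> (forall q, 0 <= h q) ->
  steady_expect (fun q => g q + h q) = (steady_expect g + steady_expect h)%E.
Proof.
move=> g0 h0; rewrite /steady_expect; under eq_integral do rewrite EFinD.
by rewrite ge0_integralD// => w _; rewrite lee_fin.
Qed.

Lemma steady_expectZ a g : 0 <= a -> (forall q, 0 <= g q) ->
  steady_expect (fun q => a * g q) = (a%:E * steady_expect g)%E.
Proof.
move=> a0 g0; rewrite /steady_expect; under eq_integral do rewrite EFinM.
by rewrite ge0_integralZl_EFin// => w _; rewrite lee_fin.
Qed.

Lemma steady_expect_cst a : steady_expect (fun=> a) = a%:E.
Proof.
rewrite /steady_expect (integral_cst (rv_prob Y) measurableT).
by rewrite [X in (_ * X)%E](probability_setT (rv_prob Y)) mule1.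
Qed.

Lemma le_steady_expect g h : (forall q, 0 <= g q) -> (forall q, g q <= h q) ->
  (steady_expect g <= steady_expect h)%E.
Proof.
move=> g0 gh; apply: ge0_le_integral => // w _; rewrite lee_fin//.
Qed.

Lemma mean_total_steady : mean_total Y = steady_expect total.
Proof.
rewrite /mean_total /rv_expect expectation.unlock; apply: eq_integral => w _.
by rewrite /total natr_sum; congr EFin; apply: eq_bigr => l _; rewrite ffunE.
Qed.

Hypothesis HYm : all_moments_finite Y.

(** A common dominating function: it controls [spread ^+ 2], the term of highest degree cancelled in
    the stationary drift inequalities. *)
Let quartic (q : {ffun 'I_L -> nat}) : R := \sum_l (q l)%:R ^+ 4.

Let quartic_ge0 q : 0 <= quartic q.
Proof. by apply: sumr_ge0 => l _; exact: exprn_ge0. Qed.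

Let quartic_fin : (steady_expect quartic < +oo)%E.
Proof.
rewrite /steady_expect /quartic; under eq_integral do rewrite -sumEFin.
rewrite ge0_integral_sum//; last first.
  by move=> l; exact: (@measurable_steady (fun q => (q l)%:R ^+ 4)).
apply: lte_sum_pinfty => l _.
apply: le_lt_trans (HYm (fun l' => if l' == l then 4%N else 0%N)).
rewrite le_eqVlt; apply/orP; left; apply/eqP.
rewrite /rv_expect expectation.unlock; apply: eq_integral => w _.
rewrite (bigD1 l)//= eqxx big1 ?mulr1 ?ffunE// => k /negbTE ->.
by rewrite expr0.
Qed.

Let fin_of_quartic C g : (forall q, 0 <= g q) -> 0 <= C ->
  (forall q, g q <= C * quartic q) -> steady_expect g \is a fin_num.
Proof.
move=> g0 C0 gC; rewrite ge0_fin_numE; last first.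
  by apply: integral_ge0 => w _; rewrite lee_fin.
apply: le_lt_trans (le_steady_expect g0 gC) _.
by rewrite steady_expectZ// lte_mul_pinfty.
Qed.

Implicit Types (q : {ffun 'I_L -> nat}).

Let square_le q : \sum_l (q l)%:R ^+ 2 <= quartic q.
Proof.
apply: ler_sum => l _; rewrite -!natrX ler_nat.
by case: (q l) => // n; exact: leq_pexp2l.
Qed.

Let total_sqr_fin : steady_expect (fun q => total q ^+ 2) \is a fin_num.
Proof.
apply: (@fin_of_quartic L%:R) => // q; first exact: sqr_ge0.
apply: le_trans (sqr_sum_le _) _; rewrite card_ord ler_wpM2l//.
Qed.

Let total_fin : steady_expect total \is a fin_num.
Proof.
apply: (@fin_of_quartic 1) => // q; first exact: total_ge0.
rewrite mul1r; apply: le_trans (square_le q); apply: ler_sum => l _.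
by rewrite -natrX ler_nat; case: (q l) => // n; rewrite -{1}(expn1 n.+1) leq_pexp2l.
Qed.

Lemma mean_total_fin_num : mean_total Y \is a fin_num.
Proof. by rewrite mean_total_steady; exact: total_fin. Qed.

Let spread_le q : spread q <= 2 * L%:R * \sum_l (q l)%:R ^+ 2 :> R.
Proof. by rewrite spreadE; have := sqr_ge0 (total q : R); lra. Qed.

Let spread_sqr_fin : steady_expect (fun q => spread q ^+ 2) \is a fin_num.
Proof.
apply: (@fin_of_quartic (4 * L%:R ^+ 3)) => [q||q]; first exact: sqr_ge0.
  by rewrite mulr_ge0// exprn_ge0.
apply: (@le_trans _ _ ((2 * L%:R * \sum_l (q l)%:R ^+ 2) ^+ 2)).
  rewrite lerXn2r ?nnegrE ?spread_ge0 ?spread_le//.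
  by rewrite !mulr_ge0// sumr_ge0// => l _; exact: sqr_ge0.
have := sqr_sum_le (fun l => (q l)%:R ^+ 2 : R); rewrite card_ord.
have -> : \sum_i ((q i)%:R ^+ 2) ^+ 2 = quartic q.
  by apply: eq_bigr => l _; rewrite -exprM.
have : 0 <= L%:R ^+ 2 :> R by exact: sqr_ge0.
move=> /ler_wpM2l h /h; lra.
Qed.

Variable eps : R.
Hypothesis eps0 : 0 < eps.
Hypothesis epsE : eps = total_mean svc - law_mean arr.
Variable mu0 : R.
Hypothesis mu00 : 0 < mu0.
Hypothesis mu0_le : forall l, mu0 <= law_mean (svc l).
Hypothesis eps_le : eps <= L%:R * mu0 / 2.

Let bnd := input_law_bounded Harr Hsvc.

Local Notation sb := (@spread_bound R L B mu0).

(** By stationarity [spread ^+ 2] and its image under the kernel have the same finite mean, which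
    cancels from the integrated drift. The terms are arranged so that both sides are sums of
    nonnegative functions. *)
Let spread_mean_le : (steady_expect spread <= sb%:E)%E.
Proof.
have sb0 : 0 <= sb by exact: spread_bound_ge0.
pose g1 q : R := K (fun q => spread q ^+ 2) q + spread q.
pose g2 q : R := spread q ^+ 2 + sb.
have sq0 q : 0 <= spread q ^+ 2 :> R by exact: sqr_ge0.
have s0 q : 0 <= spread q :> R by exact: spread_ge0.
have drift q : g1 q <= g2 q.
  by have := jsq_spread_drift L0 bnd epsE mu00 mu0_le eps_le q; rewrite /g1 /g2; lra.
have g10 q : 0 <= g1 q by rewrite addr_ge0// K_ge0.
have := le_steady_expect g10 drift.
rewrite steady_expectD//; last by move=> q; exact: K_ge0.
by rewrite steady_expectD// steady_expect_cst stationary// leeD2lE.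
Qed.

Lemma jsq_mean_total_le :
  exists2 x : R, mean_total Y = x%:E &
    2 * eps * x <= second_moment law eps + (sb + L%:R * B%:R) * Num.sqrt eps.
Proof.
set eta := Num.sqrt eps.
have eta0 : 0 < eta by rewrite sqrtr_gt0.
have eta2 : eta * eta = eps by rewrite -expr2 sqr_sqrtr// ltW.
have v0 : 0 <= second_moment law eps.
  rewrite -(mean_net_input_sqr bnd epsE); apply: sumr_ge0 => z _.
  by rewrite mulr_ge0 ?sqr_ge0// input_weight_ge0.
set v := second_moment law eps in v0 *.
pose c := L%:R * B%:R / eta.
have c0 : 0 <= c by rewrite divr_ge0 ?mulr_ge0// ltW.
have e0 := ltW eps0; have n0 := ltW eta0.
have t0 q : 0 <= total q :> R by exact: total_ge0.
have s0 q : 0 <= spread q :> R by exact: spread_ge0.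
have t20 q : 0 <= total q ^+ 2 :> R by exact: sqr_ge0.
(* The drift inequality with its negative terms moved across. In the mean, the second moment of the
   total and [c] times its mean cancel, both being finite. *)
pose g1 q : R := K (fun q => total q ^+ 2) q + (2 * eps + c) * total q.
pose g2 q : R := total q ^+ 2 + ((v + c * eps) + (eta * K spread q + c * K total q)).
have drift q : g1 q <= g2 q.
  have := jsq_total_sqr_le L0 bnd epsE q eta0; rewrite -/v -/c /g1 /g2; lra.
have ec0 : 0 <= 2 * eps + c by rewrite addr_ge0// mulr_ge0.
have g10 q : 0 <= g1 q by rewrite addr_ge0 ?K_ge0// mulr_ge0.
have vc0 : 0 <= v + c * eps by rewrite addr_ge0// mulr_ge0.
have h0 q : 0 <= eta * K spread q by rewrite mulr_ge0// K_ge0.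
have h1 q : 0 <= c * K total q by rewrite mulr_ge0// K_ge0.
have Ks0 q : 0 <= K spread q by exact: K_ge0.
have Kt0 q : 0 <= K total q by exact: K_ge0.
have Kt20 q : 0 <= K (fun q => total q ^+ 2) q by exact: K_ge0.
have h2 q : 0 <= eta * K spread q + c * K total q by rewrite addr_ge0.
have h3 q : 0 <= (v + c * eps) + (eta * K spread q + c * K total q).
  by rewrite addr_ge0.
have := le_steady_expect g10 drift.
rewrite steady_expectD//; last by move=> q; rewrite mulr_ge0.
rewrite (steady_expectD t20 h3) (steady_expectD (fun=> vc0) h2) (steady_expectD h0 h1).
rewrite (steady_expect_cst (v + c * eps)).
rewrite !steady_expectZ// !stationary//.
have sE0 : (0 <= steady_expect spread)%E.
  by apply: integral_ge0 => w _; rewrite lee_fin.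
have sf : steady_expect spread \is a fin_num.
  by rewrite ge0_fin_numE//; apply: le_lt_trans spread_mean_le (ltry _).
move: spread_mean_le; rewrite mean_total_steady.
case: (steady_expect spread) sf => // z _.
case: (steady_expect total) total_fin => // x _.
case: (steady_expect (fun q => total q ^+ 2)) total_sqr_fin => // y _.
rewrite -!EFinM -!EFinD !lee_fin => zle main; exists x => //.
have ce : c * eps = L%:R * B%:R * eta.
  by rewrite /c -eta2; field; rewrite gt_eqF.
have := ler_wpM2l n0 zle.
by move: main; rewrite ce; lra.
Qed.

End jsq_chain.

(** * Passage to the heavy-traffic limit *)

(** The limit superior is an infimum of suprema over the sets of the filter; the set on which the
    bound holds is one of them. *)
Lemma limf_esup_le (R : realType) (F : set_system R) (f : R -> \bar R) (a : R) :
  (forall dl, 0 < dl -> \forall e \near F, (f e <= (a + dl)%:E)%E) ->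
  (limf_esup (T := R) f F <= a%:E)%E.
Proof.
move=> fa; apply/lee_addgt0Pr => dl dl0; rewrite limf_esupE.
apply: ge_ereal_inf; exists (ereal_sup (f @` [set e | (f e <= (a + dl)%:E)%E])).
  by exists [set e | (f e <= (a + dl)%:E)%E] => //; exact: fa.
by apply: ge_ereal_sup => _ [e /= fe <-].
Qed.

Unset Implicit Arguments.

Theorem proposition3 (R : realType) (L Amax Smax : nat)
    (arr : R -> probability nat R) (svc : 'I_L -> probability nat R)
    (E : set R) (jsq : R -> routing_model R L) (Qbar : R -> random_vector R L)
    (HL : (0 < L)%N)
    (Hsvc_bounded : forall l, bounded_law (svc l) Smax)
    (Hsvc_mean : forall l, 0 < law_mean (svc l))
    (Harr_bounded : forall e, E e -> bounded_law (arr e) Amax)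
    (Heps_pos : forall e, E e -> 0 < e)
    (Heps : forall e, E e ->
       e = total_mean svc - law_mean (arr e))
    (Hprim : forall e, E e -> has_primitives (jsq e) (arr e) svc)
    (Hjsq : forall e, E e -> is_jsq (jsq e))
    (HQbar : forall e, E e -> steady_state (jsq e) (Qbar e))
    (HQbar_moments : forall e, E e -> all_moments_finite (Qbar e)) :
  (exists B : R -> R,
     (forall e, E e ->
        (mean_total (Qbar e) <= ((law_var (arr e) + total_var svc) / (2 * e) + B e)%:E)%E)
     /\ (fun e : R => e * B e) @ heavy_traffic E --> (0 : R)) /\
  (forall s2 : R, (fun e : R => law_var (arr e)) @ heavy_traffic E --> s2 ->
     let zeta := s2 + total_var svc in
     [/\ (limf_esup (T := R) (fun e : R => e%:E * mean_total (Qbar e)) (heavy_traffic E)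
            <= (zeta / 2)%:E)%E,
         forall (pol : R -> routing_model R L) (Qhat : R -> random_vector R L),
           (forall e, E e -> has_primitives (pol e) (arr e) svc) ->
           (forall e, E e -> steady_state (pol e) (Qhat e)) ->
           ((zeta / 2)%:E
              <= limf_einf (T := R) (fun e : R => e%:E * mean_total (Qhat e))
                   (heavy_traffic E))%E
       & (fun e : R => (e%:E * mean_total (Qbar e))%E) @ heavy_traffic E
           --> (zeta / 2)%:E]).
Proof.
pose F := within E (0 : R)^'+.
have FF : Filter F by exact: within_filter.
pose z e := law_var (arr e) + total_var svc.
pose B := maxn Amax Smax; pose M : R := L%:R * B%:R.
pose x e := fine (mean_total (Qbar e)).
have smE e : second_moment (input_law (arr e) svc) e = z e + e ^+ 2 by [].
have nearE : \forall e \near F, E e by exact: withinT.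
have xE e : E e -> mean_total (Qbar e) = (x e)%:E.
  by move=> Ee; rewrite fineK// mean_total_fin_num//; exact: HQbar_moments.
have lower e (pol : routing_model R L) (Qhat : random_vector R L) : E e ->
    has_primitives pol (arr e) svc -> steady_state pol Qhat ->
    ((z e + e ^+ 2 - M * e)%:E <= (2 * e)%:E * mean_total Qhat)%E.
  move=> Ee pe se; rewrite -smE.
  exact: (steady_mean_total_ge pe (Harr_bounded e Ee) Hsvc_bounded (Heps_pos e Ee)
    (Heps e Ee) se).
have [mu0 mu00 mu0_le] : exists2 mu0 : R, 0 < mu0 & forall l, mu0 <= law_mean (svc l).
  case: (@arg_minP _ _ _ (Ordinal HL) predT (fun l => law_mean (svc l)) isT) => l _ lP.
  by exists (law_mean (svc l)) => // k; exact: lP.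
pose C : R := @spread_bound R L B mu0 + M.
(* Large enough for both directions: the square-root term comes from the JSQ upper bound, the linear
   term from the universal lower bound, and [e ^+ 2] from the squared mean in [second_moment]. *)
pose err e : R := C * Num.sqrt e + e ^+ 2 + M * e.
have C0 : 0 <= C.
  by rewrite /C /M addr_ge0 ?mulr_ge0//; apply: spread_bound_ge0.
have err_cvg : err @ F --> (0 : R).
  rewrite /F; apply: cvg_within_filter; apply: cvg_at_right_filter.
  have err00 : err 0 = 0 by rewrite /err sqrtr0 expr0n !mulr0 !addr0.
  suff : err @ (0 : R) --> err 0 by rewrite err00.
  apply: cvgD; first apply: cvgD.
  - by apply: cvgM; [exact: cvg_cst|exact: sqrt_continuous].
  - exact: exprn_continuous.
  - by apply: cvgM; [exact: cvg_cst|exact: cvg_id].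
have e1 : 0 < L%:R * mu0 / 2 by rewrite divr_gt0 ?mulr_gt0 ?ltr0n.
(* The drift of [spread] is negative for large excess only when the slack is small compared with the
   service rates, which holds eventually. *)
have small : \forall e \near F, e <= L%:R * mu0 / 2.
  by apply: cvg_within; exact: nbhs_right_le.
have err_le : \forall e \near F, `|2 * e * x e - z e| <= err e.
  apply: filterS2 small nearE => e ele Ee; have e0 := Heps_pos e Ee.
  have := lower e _ _ Ee (Hprim e Ee) (HQbar e Ee).
  have [y] := jsq_mean_total_le (Hprim e Ee) (Harr_bounded e Ee) Hsvc_bounded
    (Hjsq e Ee) (HQbar e Ee) HL (HQbar_moments e Ee) e0 (Heps e Ee) mu00 mu0_le ele.
  rewrite xE// smE -/B -/M -/C => -[<-] up; rewrite -EFinM lee_fin => lo.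
  have Cs0 : 0 <= C * Num.sqrt e by rewrite mulr_ge0// sqrtr_ge0.
  have Me0 : 0 <= M * e by rewrite /M !mulr_ge0// ltW.
  have e20 : 0 <= e ^+ 2 by exact: sqr_ge0.
  by rewrite ler_norml /err; apply/andP; split; lra.
(* The comparison is with [z e] rather than its limit: this yields the first claim, and convergence
   of the variances enters only afterwards. *)
have gap_cvg : (fun e => e * x e - z e / 2) @ F --> (0 : R).
  have half_cvg (s : R) : (fun e => s * err e) @ F --> (0 : R).
    by rewrite -(mulr0 s); apply: cvgM => //; exact: cvg_cst.
  apply: (squeeze_cvgr _ (half_cvg (- 2^-1)) (half_cvg 2^-1)).
  by apply: filterS err_le => e; rewrite ler_norml => /andP[]; lra.
split.
  (* The exact remainder, so that the bound is an equality; [e] times it is the gap just shown to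
     vanish. *)
  exists (fun e => x e - z e / (2 * e)); split.
    by move=> e Ee; rewrite xE// lee_fin -/(z e) addrC subrK.
  move: gap_cvg; apply: cvg_trans; apply: near_eq_cvg.
  apply: filterS nearE => e /Heps_pos e0 /=.
  by field; rewrite gt_eqF.
move=> s2 var_cvg zeta.
have half_cvg : (fun e => z e / 2) @ F --> zeta / 2.
  by apply: cvgM; [apply: cvgD => //; exact: cvg_cst|exact: cvg_cst].
have ex_cvg : (fun e => e * x e) @ F --> zeta / 2.
  have -> : (fun e => e * x e) = (fun e => (e * x e - z e / 2) + z e / 2).
    by apply/funext => e; rewrite subrK.
  by rewrite -[zeta / 2]add0r; apply: cvgD.
have jsq_cvg : (fun e => (e%:E * mean_total (Qbar e))%E) @ F --> (zeta / 2)%:E.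
  have : (fun e => (e * x e)%:E) @ F --> (zeta / 2)%:E.
    by apply: cvg_EFin => //; exact: nearW.
  apply: cvg_trans; apply: near_eq_cvg; apply: filterS nearE => e Ee.
  by rewrite xE.
split => //.
- apply: limf_esup_le => dl dl0.
  have lt_dl : zeta / 2 < zeta / 2 + dl by rewrite ltrDl.
  have le_near := @cvgr_le _ _ _ FF _ _ ex_cvg _ lt_dl.
  suff : \forall e \near F, (e%:E * mean_total (Qbar e) <= (zeta / 2 + dl)%:E)%E by [].
  by apply: filterS2 le_near nearE => e ele Ee; rewrite xE// -EFinM lee_fin.
(* The limit inferior is minus the limit superior of the opposite function, so the lower bound is
   turned into an upper bound for the negated means. *)
- move=> pol Qhat Hpol HQhat; rewrite /limf_einf leeNr -EFinN.
  apply: limf_esup_le => dl dl0.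
  have lo_cvg : (fun e => z e / 2 + - (M / 2) * e) @ F --> zeta / 2.
    rewrite -[zeta / 2]addr0 -(mulr0 (- (M / 2))); apply: cvgD => //.
    apply: cvgM; first exact: cvg_cst.
    by apply: cvg_within_filter; apply: cvg_at_right_filter; exact: cvg_id.
  have lt_dl : zeta / 2 - dl < zeta / 2 by rewrite gtrBl.
  have ge_near := @cvgr_ge _ _ _ FF _ _ lo_cvg _ lt_dl.
  suff : \forall e \near F,
      (- (e%:E * mean_total (Qhat e)) <= (- (zeta / 2) + dl)%:E)%E by [].
  apply: filterS2 ge_near nearE => e ege Ee.
  have := lower e _ _ Ee (Hpol e Ee) (HQhat e Ee).
  have e20 : 0 <= e ^+ 2 by exact: sqr_ge0.
  (* The mean under an arbitrary policy may be infinite, in which case the bound is immediate. *)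
  case: (mean_total (Qhat e)) (mean_total_ge0 (Qhat e)) => [r _||//].
    by rewrite -!EFinM -EFinN !lee_fin; lra.
  by move=> _ _; rewrite gt0_muley ?lte_fin ?Heps_pos// leNye.
Qed.
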